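(* Let $F$ be a lower semi-definite self-adjoint linear operator with domain $D(F)$ in a Hilbert space $H$, let $q_F$ be its associated sesquilinear form with domain $Q(F)$, and let $m\geqslant 1$ be an integer. Suppose that the discrete spectrum of $F$ below the lower limit $\inf\sigma_{\text{ess}}(F)$ of its essential spectrum is not empty and comprises at least $m$ eigenvalues (counted with multiplicity), and let $\lambda_{\text{min}}=\lambda_1\leqslant\ldots\leqslant\lambda_m$ be the initial $m$ of them, arranged in non-decreasing order starting from the lowest one, so that each eigenvalue is repeated according to its multiplicity, except for maybe the last one. Let $X_1,\ldots,X_m$ be linearly independent eigenvectors of $F$ corresponding to the eigenvalues $\lambda_1,\ldots,\lambda_m$, i.e. $FX_k=\lambda_kX_k$. Assume that for each $k=1,\ldots,m$ a sequence of vectors $X_{kn}\in Q(F)$, $n=1,2,\ldots$, is given so that $$X_k=\lim_{n\to\infty}X_{kn}\quad\text{and}\quad \lim_{n\to\infty}q_F(X_{kn},X_{qn})=\langle X_k|FX_q\rangle\quad\text{for all }1\leqslant k,q\leqslant m,$$ where the first limit is with respect to the norm of $H$. For each $n$ put $$V_n=\operatorname{Span}\bigl(\{X_{ks}: 1\leqslant k\leqslant m,\ 1\leqslant s\leqslant n\}\bigr)\subset Q(F),$$ let $F_{V_n}$ be the linear operator in the finite-dimensional space $V_n$ generated by the restriction of the form $q_F$ to $V_n$, and (for $n$ such that $\dim V_n\geqslant m$) let $\hat\mu^{(n)}_{\text{min}}=\hat\mu^{(n)}_1\leqslant\ldots\leqslant\hat\mu^{(n)}_m$ be the initial (lowest)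 $m$ eigenvalues of $F_{V_n}$ taken in non-decreasing order so that each eigenvalue is repeated according to its multiplicity, except for maybe the last one. Then $$\lambda_k=\lim_{n\to\infty}\hat\mu^{(n)}_k\quad\text{for all }k=1,\ldots,m.$$
   Context: All Hilbert spaces are complex and separable; the scalar product $\langle X|Y\rangle$ is conjugate linear in $X$ and linear in $Y$. Linear operators $F$ in $H$ are given with a dense domain $D(F)\subset H$ and need not be bounded. A symmetric operator $F$ is called lower semi-definite if there is a real constant $C$ such that $\langle X|FX\rangle\geqslant C\,\Vert X\Vert^2$ for all $X\in D(F)$. For a self-adjoint operator $F$, the form $q_F(X,Y)=\langle X|FY\rangle$, initially defined for $X,Y\in D(F)$, is extended by means of the spectral theorem to a symmetric sesquilinear form (conjugate linear in the first argument) on the larger domain $Q(F)=D(\sqrt{|F|})$; explicitly $q_F(X,Y)=\langle |F|^{1/2}X\,|\,\operatorname{sgn}(F)|F|^{1/2}Y\rangle$ for $X,Y\in Q(F)$. If $F$ is lower semi-definite, then equivalently: $X\in Q(F)$ if and only if there is a sequence $X_n\in D(F)$ with $\Vert X_n-X\Vert\to0$ as $n\to\infty$ and $\langle X_n-X_m|F(X_n-X_m)\rangle\to0$ as $n,m\to\infty$; and $q_F(X,Y)=\lim_{n\to\infty}\langle X_n|FY_n\rangle$ for any such approximating sequences $X_n$ of $X$ and $Y_n$ of $Y$. For a finite-dimensional subspace $V\subset Q(F)$, the operator $F_V:V\to V$ generated by the restriction of $q_F$ to $V$ is the self-adjoint operator defined by $\langle Y|F_VX\rangle=q_F(Y,X)$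 for all $X,Y\in V$. The discrete spectrum of $F$ consists of the isolated eigenvalues of finite multiplicity; the essential spectrum $\sigma_{\text{ess}}(F)$ is the rest of the spectrum. Its lower limit is $\inf\sigma_{\text{ess}}(F)$ (equal to $+\infty$ if $\sigma_{\text{ess}}(F)$ is empty). *)

(* Defs.v *)
From HB Require Import structures.
From mathcomp Require Import all_boot all_order all_algebra.
From mathcomp Require Import complex sesquilinear.
From mathcomp Require Import all_classical all_reals all_analysis.

Set Implicit Arguments.
Unset Strict Implicit.
Unset Printing Implicit Defensive.

Import Order.TTheory GRing.Theory Num.Theory.
Import numFieldNormedType.Exports.
Local Open Scope classical_set_scope.
Local Open Scope complex_scope.
Local Open Scope ring_scope.

Section LinearAlgebra.
Variables (R : realType) (H : lmodType R[i]).

Definition linear_span (A : set H) : set H :=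
  [set x | exists (d : nat) (b : 'I_d -> H) (c : 'I_d -> R[i]),
     (forall i, A (b i)) /\ x = \sum_i c i *: b i].

Definition lin_indep (d : nat) (b : 'I_d -> H) : Prop :=
  forall c : 'I_d -> R[i], \sum_i c i *: b i = 0 -> forall i, c i = 0.

Definition has_dim (V : set H) (d : nat) : Prop :=
  exists b : 'I_d -> H, lin_indep b /\ V = linear_span (range b).

(* The eigenspace: the zero vector is included. *)
Definition eigenvectors (D : set H) (T : H -> H) (z : R[i]) : set H :=
  [set x | D x /\ T x = z *: x].

Definition is_eigenvalue (D : set H) (T : H -> H) (z : R[i]) : Prop :=
  exists x : H, x != 0 /\ eigenvectors D T z x.

(* [lam] lists, in non-decreasing order, the lowest [m] of the eigenvalues of
   [T] that lie in [P]. Only the largest listed value may occur fewer times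
   than its multiplicity; every smaller value occurs exactly as often as its
   multiplicity, in particular no smaller element of [P] is missing. *)
Definition initial_eigenvalues (D : set H) (T : H -> H) (P : set R)
    (m : nat) (lam : 'I_m -> R) : Prop :=
  [/\ forall j k : 'I_m, (j <= k)%N -> lam j <= lam k,
      forall k, P (lam k),
      forall k, exists d, has_dim (eigenvectors D T (lam k)%:C) d /\
                          (#|[set j | lam j == lam k]%SET| <= d)%N
    & forall mu : R, P mu -> (exists k, mu < lam k) ->
        has_dim (eigenvectors D T mu%:C) #|[set j | lam j == mu]%SET|].

Definition trial_space (m : nat) (Xs : 'I_m -> nat -> H) (n : nat) : set H :=
  linear_span [set x | exists (k : 'I_m) (s : nat),
                         (1 <= s <= n)%N /\ x = Xs k s].

End LinearAlgebra.

Section HilbertSpace.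
Variables (R : realType) (H : completeNormedModType R[i]).

(* MathComp forms are linear in the first argument; the scalar product
   conjugate linear in its first argument is obtained by exchanging them. *)
Definition scalar_product (dot : {dot H for Num.conj}) (x y : H) : R[i] :=
  dot y x.

Definition separable : Prop :=
  exists A : set H, countable A /\ dense A.

(* The values of the underlying function outside the domain are irrelevant. *)
Record operator := Operator {
  dom : set H ;
  op_fun :> H -> H ;
  dom_linear : forall (a : R[i]) x y, dom x -> dom y -> dom (a *: x + y) ;
  op_linear : forall (a : R[i]) x y, dom x -> dom y ->
    op_fun (a *: x + y) = a *: op_fun x + op_fun y ;
  dom_dense : dense dom }.

Variable dot : {dot H for Num.conj}.
Local Notation "<| x , y |>" := (scalar_product dot x y).

Definition symmetric_operator (F : operator) : Prop :=
  forall x y, dom F x -> dom F y -> <|x, F y|> = <|F x, y|>.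

(* The right-hand side of the equivalence is the graph of [F], the left-hand
   side that of its adjoint. *)
Definition self_adjoint (F : operator) : Prop :=
  forall y z, (forall x, dom F x -> <|z, x|> = <|y, F x|>) <->
              (dom F y /\ F y = z).

Definition lower_semi_definite (F : operator) : Prop :=
  symmetric_operator F /\
  exists c : R, forall x, dom F x -> c%:C * `|x| ^+ 2 <= <|x, F x|>.

Definition positive_operator (F : operator) : Prop :=
  forall x, dom F x -> 0 <= <|x, F x|>.

Definition dom2 (F : operator) : set H := [set x | dom F x /\ dom F (F x)].

(* [A] is |F|, the positive self-adjoint square root of F^2. *)
Definition is_abs (F A : operator) : Prop :=
  [/\ self_adjoint A, positive_operator A, dom2 A = dom2 F
    & forall x, dom2 F x -> A (A x) = F (F x)].

(* [B] is the positive self-adjoint square root of [A]. *)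
Definition is_sqrt (A B : operator) : Prop :=
  [/\ self_adjoint B, positive_operator B, dom2 B = dom A
    & forall x, dom A x -> B (B x) = A x].

(* [S] is sgn(F), where [A] is |F| and [B] its square root: the bounded
   self-adjoint operator with F = S |F| that vanishes on the kernel of F. As
   for all functions of F, it commutes with |F|^(1/2). *)
Definition is_sgn (F A B : operator) (S : {linear H -> H}) : Prop :=
  [/\ continuous S /\ (forall x y, <|x, S y|> = <|S x, y|>),
      dom A = dom F /\ (forall x, dom F x -> F x = S (A x)),
      forall x, dom F x -> F x = 0 -> S x = 0
    & forall x, dom B x -> dom B (S x) /\ B (S x) = S (B x)].

(* [Q] is the domain Q(F) = D(|F|^(1/2)) and [q] the sesquilinear form q_F on
   it; by the spectral theorem |F|, |F|^(1/2) and sgn(F) exist and are unique,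
   so that [Q], and [q] on [Q], are determined by [F]. *)
Definition form_of_operator (F : operator) (Q : set H) (q : H -> H -> R[i]) :
    Prop :=
  exists (A B : operator) (S : {linear H -> H}),
    [/\ is_abs F A, is_sqrt A B, is_sgn F A B S, Q = dom B
      & forall x y, Q x -> Q y -> q x y = <|B x, S (B y)|>].

(* [T] restricted to [V] is the operator on [V] generated by [q]. *)
Definition generated_operator (q : H -> H -> R[i]) (V : set H) (T : H -> H) :
    Prop :=
  forall x, V x -> V (T x) /\ (forall y, V y -> <|y, T x|> = q y x).

End HilbertSpace.

Section Spectrum.
Variables (R : realType) (H : completeNormedModType R[i]) (F : operator H).

Definition resolvent_set : set R[i] :=
  [set z | exists G : {linear H -> H},
     [/\ continuous G,
         forall y, dom F (G y) /\ F (G y) - z *: G y = y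
       & forall x, dom F x -> G (F x - z *: x) = x]].

Definition spectrum : set R[i] := ~` resolvent_set.

Definition discrete_spectrum : set R[i] :=
  [set z | [/\ isolated (spectrum : set R[i]^o) z, is_eigenvalue (dom F) F z
             & exists d, has_dim (eigenvectors (dom F) F z) d]].

Definition essential_spectrum : set R[i] := spectrum `\` discrete_spectrum.

(* The spectrum of a self-adjoint operator is real. *)
Definition inf_essential_spectrum : \bar R :=
  ereal_inf [set (complex.Re z)%:E | z in essential_spectrum].

End Spectrum.

(* Main.v *)
(* Both bounds compare Rayleigh quotients on a subspace with a lower bound for
   the form on an orthogonal complement.

   [muhat_k >= lam_k]: a combination [x] of the first [k] Ritz vectors can be
   chosen orthogonal to the [X_j] with [lam_j < lam_k]; then
   [lam_k |x|^2 <= q(x,x) <= muhat_k |x|^2].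

   [muhat_k <= lam_k + e] for large [n]: a combination of [X_1n, ..., X_kn] can
   be chosen orthogonal to the Ritz vectors with smaller Ritz value, and on
   these combinations [q] is close to its values on span(X_1, ..., X_k).

   The lower bound [<x,Fx> >= lam_k |x|^2] on the complement of the [X_j] with
   [lam_j < lam_k] is obtained without the spectral theorem. The set of [a] with
   [F >= a] there is closed, and every such [a < lam_k] can be increased: if [a]
   is in the resolvent set, by the Cauchy-Schwarz inequality for the form
   [<x,(F-a)y>]; otherwise [a] is an isolated eigenvalue, the gap around it gives
   [|(F-a)x|^2 >= delta <x,(F-a)x>], hence [F >= a + delta] on the range of
   [F - a], which is dense as the eigenvectors for [a] have been removed. It
   extends to [Q(F)] because [D(F)] is a core of [|F|^(1/2)]. *)
Require Import Defs.
From mathcomp Require Import all_boot all_order all_algebra.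
From mathcomp Require Import complex sesquilinear.
From mathcomp Require Import all_classical all_reals all_analysis.
From mathcomp Require Import ring lra.
Set Implicit Arguments.
Unset Strict Implicit.
Unset Printing Implicit Defensive.
Import Order.TTheory GRing.Theory Num.Theory.
Import numFieldNormedType.Exports.
Local Open Scope classical_set_scope.
Local Open Scope complex_scope.
Local Open Scope ring_scope.

(** * Real semi-scalar products *)

(** Source of all the Cauchy-Schwarz inequalities below. The case [r = 0] is included because the
    forms concerned may be degenerate. *)
Lemma discriminant_le (R : realFieldType) (p c r : R) :
  (forall t, 0 <= p + 2 * (t * c) + t ^+ 2 * r) -> 0 <= r -> c ^+ 2 <= p * r.
Proof.
move=> h; rewrite le0r => /orP[/eqP r0|r0].
  have [->|c0] := eqVneq c 0; first by rewrite expr0n r0 mulr0.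
  have := h (- (p + 1) / (2 * c)).
  rewrite r0 (_ : p + _ + _ = -1); last by field.
  by rewrite lerNr oppr0 ler10.
have := h (- c / r).
rewrite (_ : p + _ + _ = (p * r - c ^+ 2) / r); last by field; rewrite gt_eqF.
by rewrite pmulr_lge0 ?invr_gt0 // subr_ge0.
Qed.

(** The space stays complex but only real scalars enter, so that all order arguments take place in
    [R]. Instances are the real part of the scalar product and a graph product on pairs. *)
Definition real_form (R : realType) (V : lmodType R[i]) (s : V -> V -> R) :=
  [/\ forall x y, s x y = s y x,
      forall x y z, s x (y + z) = s x y + s x z,
      forall (a : R) x y, s x (a%:C *: y) = a * s x y
    & forall x, 0 <= s x x].

Definition real_linear (R : realType) (V : lmodType R[i]) (D : set V) :=
  D 0 /\ forall (a : R) x y, D x -> D y -> D (a%:C *: x + y).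

Section RealForm.
Variables (R : realType) (V : lmodType R[i]) (s : V -> V -> R).
Hypothesis sP : real_form s.

Definition form_norm (x : V) : R := Num.sqrt (s x x).
Local Notation nrm := form_norm.

Lemma form_sym x y : s x y = s y x. Proof. by case: sP. Qed.
Lemma formDr x y z : s x (y + z) = s x y + s x z. Proof. by case: sP. Qed.
Lemma formDl x y z : s (y + z) x = s y x + s z x.
Proof. by rewrite form_sym formDr !(form_sym x). Qed.
Lemma formZr (a : R) x y : s x (a%:C *: y) = a * s x y. Proof. by case: sP. Qed.
Lemma formZl (a : R) x y : s (a%:C *: y) x = a * s y x.
Proof. by rewrite form_sym formZr form_sym. Qed.
Lemma formNr x y : s x (- y) = - s x y.
Proof. by rewrite -scaleN1r -[- 1](rmorphN1 (real_complex R)) formZr mulN1r. Qed.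
Lemma formNl x y : s (- y) x = - s y x.
Proof. by rewrite form_sym formNr form_sym. Qed.
Lemma form0r x : s x 0 = 0.
Proof. by rewrite -(scale0r x) (formZr 0) mul0r. Qed.
Lemma form0l x : s 0 x = 0. Proof. by rewrite form_sym form0r. Qed.
Lemma form_ge0 x : 0 <= s x x. Proof. by case: sP. Qed.

Definition formE :=
  (formDl, formDr, formNl, formNr, formZl, formZr, form0l, form0r).

Lemma form_norm_ge0 x : 0 <= nrm x. Proof. exact: sqrtr_ge0. Qed.
Lemma form_norm_sqr x : nrm x ^+ 2 = s x x.
Proof. by rewrite sqr_sqrtr // form_ge0. Qed.

Lemma form_Cauchy_Schwarz_sqr x y : s x y ^+ 2 <= s x x * s y y.
Proof.
apply: discriminant_le (form_ge0 y) => t.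
have := form_ge0 (x + t%:C *: y); rewrite !formE (form_sym y x).
by lra.
Qed.

Lemma form_Cauchy_Schwarz x y : `|s x y| <= nrm x * nrm y.
Proof.
rewrite -(@ler_pXn2r _ 2) ?nnegrE ?mulr_ge0 ?form_norm_ge0 //.
by rewrite exprMn !form_norm_sqr real_normK ?num_real // form_Cauchy_Schwarz_sqr.
Qed.

Lemma form_le_norm x y : s x y <= nrm x * nrm y.
Proof. exact: le_trans (ler_norm _) (form_Cauchy_Schwarz _ _). Qed.

Lemma form_normN x : nrm (- x) = nrm x.
Proof. by rewrite /nrm !formE opprK. Qed.

Lemma form_norm_distC x y : nrm (x - y) = nrm (y - x).
Proof. by rewrite -form_normN opprB. Qed.

Lemma form_norm_triangle x y : nrm (x + y) <= nrm x + nrm y.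
Proof.
rewrite -(@ler_pXn2r _ 2) ?nnegrE ?addr_ge0 ?form_norm_ge0 //.
rewrite sqrrD !form_norm_sqr !formE (form_sym y x).
by have := form_le_norm x y; lra.
Qed.

Lemma form_normZ (a : R) x : nrm (a%:C *: x) = `|a| * nrm x.
Proof.
by rewrite /nrm !formE mulrA -expr2 sqrtrM ?sqr_ge0 // sqrtr_sqr.
Qed.

(* A minimising sequence for the distance from [y] to [L]; no completeness is
   needed, the caller passes to the limit. *)
Lemma approximate_projection (L : set V) (y : V) : real_linear L ->
  exists l : nat -> V, [/\ forall n, L (l n),
    forall n p, s (l n - l p) (l n - l p) <= 2 * n.+1%:R^-1 + 2 * p.+1%:R^-1
  & forall v, L v -> forall n, s v (y - l n) ^+ 2 <= n.+1%:R^-1 * s v v].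
Proof.
move=> [L0 LZ].
pose A := [set s (y - l) (y - l) | l in L].
have Ainf : has_inf A.
  split; first by exists (s (y - 0) (y - 0)), 0.
  by exists 0 => _ [l _ <-]; exact: form_ge0.
pose d := inf A.
have dle l : L l -> d <= s (y - l) (y - l).
  by move=> Ll; apply: ge_inf; [case: Ainf|exists l].
have /choice[l lP] : forall n : nat, exists l,
    L l /\ s (y - l) (y - l) <= d + n.+1%:R^-1.
  move=> n; have n0 : 0 < (n.+1%:R^-1 : R) by rewrite invr_gt0 ltr0n.
  by have [_ [l Ll <-] /ltW] := inf_adherent n0 Ainf; exists l.
exists l; split => [n|n p|v Lv n]; first by case: (lP n).
  have [Ln hn] := lP n; have [Lp hp] := lP p.
  (* The midpoint of [l n] and [l p] lies in [L]; the parallelogram law then gives the Cauchy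
     rate. *)
  have Lm : L ((2^-1)%:C *: l n + ((2^-1)%:C *: l p + 0)).
    exact: (LZ _ _ _ Ln (LZ _ _ _ Lp L0)).
  have := dle _ Lm; rewrite addr0.
  move: hn hp; rewrite !formE (form_sym (l n) y) (form_sym (l p) y) (form_sym (l p) (l n)).
  move: (n.+1%:R^-1) (p.+1%:R^-1) => a b.
  by lra.
have [Ln hn] := lP n.
(* Passing from [l n] to [l n - t v] lowers the squared distance by at most [n.+1%:R^-1], which is a
   nonnegative quadratic in [t]. *)
apply: discriminant_le (form_ge0 v) => t.
have := dle _ (LZ (- t) _ _ Lv Ln).
move: hn; rewrite !formE (form_sym v y) (form_sym (l n) v) (form_sym (l n) y).
move: (n.+1%:R^-1) => a.
by lra.
Qed.

End RealForm.

(* A continuous induction on the constant [a] in [a * N <= E]. *)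
Lemma inequality_induction (R : realType) (T : Type) (D : set T) (N E : T -> R)
    (c lam : R) :
  (forall x, D x -> 0 <= N x) -> c <= lam ->
  (forall x, D x -> c * N x <= E x) ->
  (forall a, c <= a -> a < lam -> (forall x, D x -> a * N x <= E x) ->
     exists2 eta, 0 < eta & forall x, D x -> (a + eta) * N x <= E x) ->
  forall x, D x -> lam * N x <= E x.
Proof.
move=> N0 cl hc step.
pose A := [set a | c <= a <= lam /\ forall x, D x -> a * N x <= E x].
have Asup : has_sup A.
  by split; [exists c; rewrite /A /= lexx cl|exists lam => a [/andP[]]].
have sl : sup A <= lam by apply: ge_sup; [case: Asup|move=> a [/andP[]]].
have cs : c <= sup A by apply: ub_le_sup; [case: Asup|rewrite /A /= lexx cl].
have hs x : D x -> sup A * N x <= E x.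
  move=> Dx; apply/ler_addgt0Pr => e e0.
  (* With this accuracy, replacing [sup A] by a nearby [a] costs at most [e]; the summand [1] covers
     [N x = 0]. *)
  have e1 : 0 < e / (1 + N x) by rewrite divr_gt0 // ltr_wpDr ?N0.
  have [a [_ /(_ x Dx) ha] hlt] := sup_adherent e1 Asup.
  have Nx := N0 x Dx.
  apply: (@le_trans _ _ ((a + e / (1 + N x)) * N x)).
    by rewrite ler_wpM2r // -lerBlDr ltW.
  rewrite mulrDl lerD // mulrAC ler_pdivrMr ?ltr_wpDr //.
  by rewrite ler_pM2l // lerDr.
case: (leP lam (sup A)) => [ls|sltl] x Dx.
  by rewrite (_ : lam = sup A) ?hs //; apply/eqP; rewrite eq_le ls.
have [eta eta0 he] := step _ cs sltl hs.
pose a := Num.min (sup A + eta) lam.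
suff : a <= sup A by rewrite ge_min !leNgt sltl orbF ltrDl eta0.
apply: ub_le_sup; first by case: Asup.
split; first by rewrite ge_min lexx orbT andbT le_min cl andbT ler_wpDr // ltW.
move=> z Dz; apply: le_trans (he z Dz).
by rewrite ler_wpM2r ?N0 // ge_min lexx.
Qed.

(** * Lower bounds of symmetric operators *)

(** Turns the explicit rates [n.+1%:R^-1] of the approximating sequences into exact identities. *)
Lemma le_harmonic0 (R : realType) (x c : R) :
  (forall n, x <= n.+1%:R^-1 * c) -> x <= 0.
Proof.
move=> h; rewrite leNgt; apply/negP => x0.
have c0 : 0 < c by have := lt_le_trans x0 (h 0); rewrite invr1 mul1r.
have [n hn] : exists n : nat, c / x < n.+1%:R.
  exists (Num.bound (c / x)); apply: lt_trans (archi_boundP _) _.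
    by rewrite divr_ge0 ?ltW.
  by rewrite ltr_nat.
have := h n; rewrite mulrC ler_pdivlMr ?ltr0n // leNgt => /negP; apply.
by rewrite mulrC -ltr_pdivrMr.
Qed.

Section SymmetricOperator.
Variables (R : realType) (V : lmodType R[i]) (s : V -> V -> R).
Hypothesis sP : real_form s.
Hypothesis s_definite : forall x, s x x = 0 -> x = 0.
Local Notation nrm := (form_norm s).

(** [M] plays the role of the Hilbert space and [D] that of the domain. In the applications both are
    cut down to the orthogonal complement of some eigenvectors, which [T] leaves invariant. *)
Definition symmetric_on (M D : set V) (T : V -> V) :=
  [/\ real_linear M, real_linear D /\ D `<=` M,
      forall x, D x -> M (T x),
      forall (a : R) x y, D x -> D y ->
        T (a%:C *: x + y) = a%:C *: T x + T y
    & forall x y, D x -> D y -> s x (T y) = s (T x) y].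

(** A bounded right inverse of [T - b], given as a mere function: that it is also a left inverse,
    symmetric and compatible with differences is derived from the symmetry of [T]. *)
Definition solution (M D : set V) (T : V -> V) (b C : R) (K : V -> V) :=
  0 < C /\ forall y, M y ->
    [/\ D (K y), T (K y) = b%:C *: K y + y & nrm (K y) <= C * nrm y].

Definition regular_value (M D : set V) (T : V -> V) (b : R) :=
  exists C K, solution M D T b C K.

Variables (M D : set V) (T : V -> V).
Hypothesis MDT : symmetric_on M D T.

Let Mlin : real_linear M. Proof. by case: MDT. Qed.
Let Dlin : real_linear D. Proof. by case: MDT => _ []. Qed.
Let DM x : D x -> M x. Proof. by case: MDT => _ [_ h] _ _ _; exact: h. Qed.
Let TM x : D x -> M (T x). Proof. by case: MDT => _ _ h _ _; exact: h. Qed.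
Let Tlin (a : R) x y : D x -> D y -> T (a%:C *: x + y) = a%:C *: T x + T y.
Proof. by case: MDT => _ _ _ h _; exact: h. Qed.
Let Tsym x y : D x -> D y -> s x (T y) = s (T x) y.
Proof. by case: MDT => _ _ _ _ h; exact: h. Qed.

Let addrNZ (x y : V) : x - y = (-1)%:C *: y + x.
Proof. by rewrite (rmorphN1 (real_complex R)) scaleN1r addrC. Qed.
Let form_ext x y : (forall v, s v x = s v y) -> x = y.
Proof.
move=> h; apply/eqP; rewrite -subr_eq0; apply/eqP/s_definite.
by rewrite (formDr sP) (formNr sP) h subrr.
Qed.

Lemma real_linearB (L : set V) x y : real_linear L -> L x -> L y -> L (x - y).
Proof. by move=> [_ h] Lx Ly; rewrite addrNZ; exact: h. Qed.
Lemma real_linearZ (L : set V) (a : R) x : real_linear L -> L x -> L (a%:C *: x).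
Proof. by move=> [L0 h] Lx; rewrite -[_ *: _]addr0; exact: h. Qed.

Let TB x y : D x -> D y -> T (x - y) = T x - T y.
Proof. by move=> Dx Dy; rewrite !addrNZ Tlin. Qed.
Let T0 : T 0 = 0.
Proof.
have [D0 _] := Dlin.
by have := TB D0 D0; rewrite !subrr.
Qed.
Let TZ (a : R) x : D x -> T (a%:C *: x) = a%:C *: T x.
Proof.
have [D0 _] := Dlin.
by move=> Dx; have := Tlin a Dx D0; rewrite T0 !addr0.
Qed.

(* Cauchy-Schwarz for the form [s x (T y - b y)] applied to [x] and to the
   solution [z] of [T z - b z = x]. *)
Lemma bound_improvement (b C : R) : 0 < C ->
  (forall x, D x -> exists z, [/\ D z, T z = b%:C *: z + x
                                & nrm z <= C * nrm x]) ->
  (forall x, D x -> b * s x x <= s x (T x)) ->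
  forall x, D x -> (b + C^-1) * s x x <= s x (T x).
Proof.
move=> C0 hK hb x Dx; have [z [Dz Tz zC]] := hK x Dx.
have sxTz : s z (T x) = s x x + b * s x z.
  by rewrite Tsym // Tz !(formE sP) (form_sym sP z x); lra.
have z0 : 0 <= s x z.
  by have := hb z Dz; rewrite Tz !(formE sP) (form_sym sP z x); lra.
have h : s x x ^+ 2 <= (s x (T x) - b * s x x) * s x z.
  apply: discriminant_le z0 => t.
  have := hb _ ((Dlin.2) t _ _ Dz Dx).
  rewrite Tlin // !(formE sP) sxTz Tz !(formE sP) (form_sym sP z x).
  by lra.
have zle : s x z <= C * s x x.
  apply: le_trans (form_le_norm sP _ _) _.
  rewrite -(form_norm_sqr sP) expr2 mulrA mulrC.
  by rewrite ler_wpM2r ?form_norm_ge0.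
have := form_ge0 sP x; rewrite le_eqVlt => /orP[/eqP x0|x0].
  by have := hb x Dx; rewrite -x0 !mulr0.
have e0 : 0 <= s x (T x) - b * s x x by rewrite subr_ge0 hb.
have : s x x ^+ 2 <= (s x (T x) - b * s x x) * (C * s x x).
  by apply: le_trans h _; rewrite ler_wpM2l.
rewrite expr2 mulrA ler_pM2r // mulrC -ler_pdivrMl //; lra.
Qed.

(** A vector [d] of [D] with [T d = b d] has the form [T z - b z], and symmetry gives [s d d = 0];
    this is applied to the difference of the two sides. *)
Lemma solution_unique (b C : R) K x : solution M D T b C K -> D x ->
  K (T x - b%:C *: x) = x.
Proof.
move=> [_ hK] Dx.
have My : M (T x - b%:C *: x).
  by apply: real_linearB => //; [exact: TM|apply: real_linearZ => //; exact: DM].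
have [Dk Tk _] := hK _ My.
set k := K _ in Dk Tk *.
apply/eqP; rewrite -subr_eq0; apply/eqP/s_definite.
have Dd : D (k - x) by exact: real_linearB.
have Td : T (k - x) = b%:C *: (k - x).
  by rewrite TB // Tk scalerBr addrCA addrAC subrr add0r addrC.
have [Dz Tz _] := hK _ (DM Dd).
have := Tsym Dd Dz; rewrite Td Tz !(formE sP) => h.
by move: h; set u := K _; lra.
Qed.

Lemma solution_lower (b C : R) K x : solution M D T b C K -> D x ->
  nrm x <= C * nrm (T x - b%:C *: x).
Proof.
move=> hK Dx; have My : M (T x - b%:C *: x).
  by apply: real_linearB => //; [exact: TM|apply: real_linearZ => //; exact: DM].
by have [_ _] := hK.2 _ My; rewrite (solution_unique hK Dx).
Qed.

Lemma solution_sym (b C : R) K x y : solution M D T b C K -> M x -> M y ->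
  s (K x) y = s x (K y).
Proof.
move=> [_ hK] Mx My; have [Dx Tx _] := hK _ Mx; have [Dy Ty _] := hK _ My.
by have := Tsym Dx Dy; rewrite Tx Ty !(formE sP); lra.
Qed.

Lemma solution_sub (b C : R) K x y : solution M D T b C K -> M x -> M y ->
  K (x - y) = K x - K y.
Proof.
move=> hK Mx My.
have [Dx Tx _] := hK.2 _ Mx; have [Dy Ty _] := hK.2 _ My.
rewrite -(solution_unique hK (real_linearB Dlin Dx Dy)) TB // Tx Ty.
by congr (K _); apply: form_ext => v; rewrite !(formE sP); ring.
Qed.

(* With [f] the best constant found so far, apply [(T - beta)^2 - f^2], which
   factors through the regular values [beta + f] and [beta - f], to vectors
   which nearly attain [f]. *)
Lemma regular_interval_bound (beta r : R) : 0 <= r ->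
  (forall b, `|b - beta| < r -> regular_value M D T b) ->
  forall x, D x ->
    r ^+ 2 * s x x <= s (T x - beta%:C *: x) (T x - beta%:C *: x).
Proof.
move=> r0 reg.
apply: (inequality_induction (c := 0)); rewrite ?sqr_ge0 //.
- by move=> x _; exact: form_ge0.
- by move=> x _; rewrite mul0r; exact: form_ge0.
move=> a a0 ar ha.
pose g := Num.sqrt a.
have g0 : 0 <= g by exact: sqrtr_ge0.
have ag : a = g ^+ 2 by rewrite sqr_sqrtr.
have gr : g < r by rewrite -(@ltr_pXn2r _ 2) ?nnegrE // -ag.
have [C0 [K hK]] : regular_value M D T beta.
  by apply: reg; rewrite subrr normr0 (le_lt_trans g0).
have [C1 [K1 hK1]] : regular_value M D T (beta - g).
  by apply: reg; rewrite addrAC subrr add0r normrN ger0_norm.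
have [C2 [K2 hK2]] : regular_value M D T (beta + g).
  by apply: reg; rewrite addrAC subrr add0r ger0_norm.
have [C1p _] := hK1; have [C2p _] := hK2.
pose C := (C1 * C2) ^+ 2.
have Cp : 0 < C by rewrite exprn_gt0 // mulr_gt0.
(* The increment is small enough for [C * eta * (a + eta) <= 1], which contradicts the strict
   reverse inequality reached at the end. *)
pose eta := Num.min 1 (C * (a + 1))^-1.
have Ca : 0 < C * (a + 1) by rewrite mulr_gt0 // ltr_wpDl.
have eta0 : 0 < eta by rewrite lt_min ltr01 invr_gt0.
have eta1 : eta <= 1 by rewrite ge_min lexx.
have Ceta : C * eta * (a + eta) <= 1.
  have h : C * (a + 1) * eta <= 1.
    by rewrite mulrC -ler_pdivlMr // div1r ge_min lexx orbT.
  apply: le_trans h; rewrite mulrAC ler_wpM2r ?(ltW eta0) //.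
  by rewrite ler_pM2l // lerD2l.
exists eta => // x Dx.
move yE: (T x - _) => y.
have [Du Tu _] := hK.2 _ (DM Dx); set u := K x in Du Tu *.
(* With [(T - beta) u = x] one has [w = (T - beta + g) u] and [(T - beta - g) w = y - a u], so the
   two regular values bound [u] by [y - a u]. *)
pose w := x + g%:C *: u.
have Dw : D w by rewrite /w addrC; apply: Dlin.2.
have Tw : T w - (beta + g)%:C *: w = y - a%:C *: u.
  rewrite /w [x + _]addrC Tlin // Tu ag -yE.
  by apply: form_ext => v; rewrite !(formE sP); ring.
have Tw2 : T u - (beta - g)%:C *: u = w.
  by rewrite Tu /w; apply: form_ext => v; rewrite !(formE sP); ring.
have le1 : nrm u <= C1 * nrm w by have := solution_lower hK1 Du; rewrite Tw2.
have le2 : nrm w <= C2 * nrm (y - a%:C *: u).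
  by have := solution_lower hK2 Dw; rewrite Tw.
(* The square of [y - a u] is expanded with [s y u = s x x] and with [a * s u u <= s x x], the
   hypothesis at [u]. *)
have le3 : s u u <= C * (s y y - a * s x x).
  have yu : s y u = s x x.
    by rewrite -yE !(formE sP) -Tsym // Tu !(formE sP); lra.
  have hu := ha u Du; rewrite Tu (addrC (_ *: _)) addrK in hu.
  have : s u u <= C * s (y - a%:C *: u) (y - a%:C *: u).
    rewrite -!(form_norm_sqr sP) /C -exprMn ler_pXn2r ?nnegrE.
    + by apply: le_trans le1 _; rewrite -mulrA ler_pM2l.
    + by [].
    + by rewrite ?nnegrE form_norm_ge0.
    + by rewrite ?nnegrE mulr_ge0 ?form_norm_ge0 // mulr_ge0 // ltW.
  move=> /le_trans; apply; rewrite ler_pM2l // !(formE sP) (form_sym sP u y) yu.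
  have := ler_wpM2l a0 hu; lra.
have cs : s x x ^+ 2 <= s y y * s u u.
  have yu : s y u = s x x.
    by rewrite -yE !(formE sP) -Tsym // Tu !(formE sP); lra.
  by rewrite -yu; exact: form_Cauchy_Schwarz_sqr.
have y0 := form_ge0 sP y.
have x0 := form_ge0 sP x.
rewrite leNgt; apply/negP => lt.
have xp : 0 < s x x.
  by rewrite lt_neqAle x0 andbT eq_sym; apply/eqP => x1; move: lt; rewrite x1 mulr0 ltNge y0.
have h1 : C * (s y y - a * s x x) <= C * (eta * s x x).
  by rewrite ler_pM2l //; lra.
have h2 : s x x ^+ 2 <= s y y * (C * (eta * s x x)).
  by apply: le_trans cs _; rewrite ler_wpM2l // (le_trans le3).
have h3 : s x x <= s y y * (C * eta).
  by rewrite -(ler_pM2r xp) -expr2 (le_trans h2) // !mulrA.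
have h4 : s y y * (C * eta) < (a + eta) * s x x * (C * eta).
  by rewrite ltr_pM2r // mulr_gt0.
have := le_lt_trans h3 h4.
rewrite mulrAC -[ltLHS]mul1r ltr_pM2r // mulrC ltNge.
by rewrite Ceta.
Qed.

(** The Cauchy rate is the one delivered by [approximate_projection]. *)
Definition complete_for (L : set V) := forall u : nat -> V,
  (forall n, L (u n)) ->
  (forall n p, s (u n - u p) (u n - u p) <= 2 * n.+1%:R^-1 + 2 * p.+1%:R^-1) ->
  exists2 l, L l & forall n, s (u n - l) (u n - l) <= 2 * n.+1%:R^-1.

(** A resolvent [K] at a point below [a] is bounded first on the range of [T - a], then by density
    on [M]; [bound_improvement] converts its norm bound into the lower bound. *)
Lemma isolated_bound (a delta : R) : 0 < delta -> complete_for M ->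
  (forall b, b != a -> `|b - a| < delta -> regular_value M D T b) ->
  (forall x, D x -> T x = a%:C *: x -> x = 0) ->
  (forall x, D x -> a * s x x <= s x (T x)) ->
  forall x, D x -> (a + delta) * s x x <= s x (T x).
Proof.
move=> d0 Mc reg ker Ta.
(* The regular interval has centre [a + delta / 2] and radius [delta / 2]; the terms
   [(delta / 2) ^+ 2 * s x x] cancel. *)
have gap x : D x ->
    delta * s x (T x - a%:C *: x) <= s (T x - a%:C *: x) (T x - a%:C *: x).
  move=> Dx; have h : (delta / 2) ^+ 2 * s x x <=
      s (T x - (a + delta / 2)%:C *: x) (T x - (a + delta / 2)%:C *: x).
    apply: regular_interval_bound => //; first by rewrite divr_ge0 // ltW.
    move=> b; rewrite ltr_norml => /andP[h1 h2]; apply: reg.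
      by apply/eqP => ba; move: h1; rewrite ba; lra.
    by rewrite ltr_norml; apply/andP; split; lra.
  move: h; rewrite -subr_ge0 -[in X in _ -> X]subr_ge0.
  rewrite (_ : s (T x - _) _ - _ = s (T x - a%:C *: x) (T x - a%:C *: x)
    - delta * s x (T x - a%:C *: x)) //.
  by rewrite !(formE sP) (form_sym sP (T x) x); field.
have range v : D v -> D (T v - a%:C *: v) ->
    delta * s (T v - a%:C *: v) (T v - a%:C *: v) <=
    s (T v - a%:C *: v) (T (T v - a%:C *: v) - a%:C *: (T v - a%:C *: v)).
  move=> Dv; have := gap v Dv; move uE: (T v - a%:C *: v) => u gv Du.
  have e0 x : D x -> 0 <= s x (T x - a%:C *: x).
    by move=> Dx; have := Ta x Dx; rewrite !(formE sP); lra.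
  have vu : s v (T u - a%:C *: u) = s u u.
    have -> : s u u = s (T v - a%:C *: v) u by rewrite uE.
    by rewrite !(formE sP) Tsym.
  (* Cauchy-Schwarz at [v] and [u] for the form [s x (T y - a y)], nonnegative by assumption; its
     mixed value is [s u u]. *)
  have cs : s u u ^+ 2 <= s v (T v - a%:C *: v) * s u (T u - a%:C *: u).
    apply: discriminant_le (e0 u Du) => t.
    have huv : s u (T v) = s v (T u) by rewrite Tsym // form_sym.
    have vTu : s v (T u) = s u u + a * s v u by rewrite -vu !(formE sP); ring.
    have := e0 _ (Dlin.2 t _ _ Du Dv).
    by rewrite Tlin // !(formE sP) huv vTu (form_sym sP u v); lra.
  have := form_ge0 sP u; rewrite le_eqVlt => /orP[/eqP u0|u0].
    by rewrite -u0 mulr0 e0.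
  rewrite -(ler_pM2l u0) mulrCA -expr2.
  apply: (@le_trans _ _ (delta * (s v (T v - a%:C *: v) * s u (T u - a%:C *: u)))).
    by rewrite ler_pM2l.
  by rewrite mulrA ler_wpM2r ?e0 // uE.
(* The point [a - eps] is regular, and on the range of [T - a] the operator [T - (a - eps)] is at
   least [delta + eps]; hence the constant [c] below. *)
pose eps := delta / 2.
have eps0 : 0 < eps by rewrite divr_gt0.
have [C [K hK]] : regular_value M D T (a - eps).
  apply: reg; first by apply/eqP; lra.
  rewrite addrAC subrr add0r normrN ger0_norm ?ltW // /eps; lra.
have [C0 hKM] := hK.
pose c := (delta + eps)^-1.
have c0 : 0 < c by rewrite invr_gt0 addr_gt0.
(* [K] commutes with [T - a]: it maps [T x - a x] to [T v - a v] with [v = K x], and to this vector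
   [range] applies. *)
have contraction x : D x -> nrm (K (T x - a%:C *: x)) <= c * nrm (T x - a%:C *: x).
  move=> Dx; have [Dv Tv _] := hKM _ (DM Dx).
  set v := K x in Dv Tv.
  have uE : T v - a%:C *: v = x - eps%:C *: v.
    by rewrite Tv; apply: form_ext => z; rewrite !(formE sP); ring.
  have Du : D (T v - a%:C *: v).
    by rewrite uE; apply: real_linearB => //; apply: real_linearZ.
  have Tu : T (T v - a%:C *: v) - (a - eps)%:C *: (T v - a%:C *: v) =
            T x - a%:C *: x.
    rewrite {1}uE TB ?TZ //; last exact: real_linearZ.
    by rewrite Tv; apply: form_ext => z; rewrite !(formE sP); ring.
  have -> : K (T x - a%:C *: x) = T v - a%:C *: v.
    by rewrite -Tu; exact: solution_unique hK Du.
  have := range v Dv Du.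
  move: Tu; move: (T v - a%:C *: v) => u; move: (T x - _) => w Tu hu.
  have : (delta + eps) * s u u <= nrm u * nrm w.
    apply: le_trans (form_le_norm sP _ _).
    by move: hu; rewrite -Tu !(formE sP); lra.
  have [u0|u0] := eqVneq (nrm u) 0.
    by rewrite u0 mulr_ge0 ?form_norm_ge0 // ltW.
  rewrite -(form_norm_sqr sP) expr2 mulrCA ler_pM2l.
    by rewrite /c ler_pdivlMl // addr_gt0.
  by rewrite lt_neqAle eq_sym u0 form_norm_ge0.
have dense_range y : M y -> exists2 l, forall n, exists2 x, D x & l n = T x - a%:C *: x
    & forall n, s (l n - y) (l n - y) <= 2 * n.+1%:R^-1.
  move=> My; pose L := [set T x - a%:C *: x | x in D].
  have LM : L `<=` M.
    move=> _ [x Dx <-]; apply: real_linearB => //; first exact: TM.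
    by apply: real_linearZ => //; exact: DM.
  have Llin : real_linear L.
    split; first by exists 0; [exact: Dlin.1|rewrite T0 scaler0 subrr].
    move=> t _ _ [x Dx <-] [z Dz <-]; exists (t%:C *: x + z); first exact: Dlin.2.
    by rewrite Tlin //; apply: form_ext => v; rewrite !(formE sP); ring.
  have [l [Ll lc lo]] := approximate_projection sP y Llin.
  have [p Mp lp] := Mc l (fun n => LM _ (Ll n)) lc.
  have orth v : L v -> s v (y - p) = 0.
    move=> Lv; apply/eqP; rewrite -sqrf_eq0 eq_le sqr_ge0 andbT.
    apply: (@le_harmonic0 _ _ (6 * s v v)) => n.
    have h1 := lo v Lv n.
    have h2 : s v (l n - p) ^+ 2 <= s v v * (2 * n.+1%:R^-1).
      apply: le_trans (form_Cauchy_Schwarz_sqr sP _ _) _.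
      by rewrite ler_wpM2l ?form_ge0.
    have -> : s v (y - p) = s v (y - l n) + s v (l n - p) by rewrite !(formE sP); ring.
    move: h1 h2; move: (s v (y - l n)) (s v (l n - p)) (n.+1%:R^-1) => i j k.
    by have := sqr_ge0 (i - j); lra.
  have Mr : M (y - p) by exact: real_linearB.
  have [Dk Tk _] := hKM _ Mr.
  (* The residual [r = y - p] is orthogonal to the range of [T - a]. For [w = r - eps K r],
     orthogonality to [(T - a) (K w) = w - eps K w] and the symmetry of [K] give [s w w = 0]. Hence
     [r] lies in [D] and [T - a] annihilates it. *)
  have rK : y - p = eps%:C *: K (y - p).
    apply/eqP; rewrite -subr_eq0; apply/eqP/s_definite.
    move: Mr Dk Tk orth; move: (y - p) => r Mr Dk Tk orth.
    have : M (r - eps%:C *: K r).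
      by apply: real_linearB => //; apply: real_linearZ => //; exact: DM.
    move wE: (r - _) => w Mw; have [Dw Tw _] := hKM _ Mw.
    have := orth (T (K w) - a%:C *: K w) (ex_intro2 _ _ _ Dw erefl).
    have -> : s w w = s w (r - eps%:C *: K r) by rewrite wE.
    by rewrite Tw !(formE sP) (solution_sym hK Mw Mr); lra.
  have Dr : D (y - p) by rewrite rK; exact: real_linearZ.
  have y0 : y - p = 0.
    apply: ker => //; rewrite {1}rK TZ // Tk.
    rewrite [X in a%:C *: X]rK [X in _ + X]rK.
    by apply: form_ext => v; move: (K _) => k; rewrite !(formE sP); ring.
  exists l => [n|n]; first by have [x Dx <-] := Ll n; exists x.
  by move/eqP: y0; rewrite subr_eq0 => /eqP ->.
have Kc y : M y -> nrm (K y) <= c * nrm y.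
  move=> My; have [l lD ly] := dense_range y My.
  apply/ler_addgt0Pr => e e0.
  (* Replacing [y] by a point of the range at distance [eta] costs [c * eta] in the bound and
     [C * eta] in [K y], together [e]. *)
  pose eta := e / (c + C).
  have eta0 : 0 < eta by rewrite divr_gt0 // addr_gt0.
  have [n hn] : exists n, nrm (l n - y) <= eta.
    apply: contrapT => /forallNP h.
    suff : eta ^+ 2 <= 0 by rewrite leNgt exprn_gt0.
    apply: (@le_harmonic0 _ _ 2) => n; rewrite mulrC.
    apply: le_trans (ly n); rewrite -(form_norm_sqr sP).
    rewrite ler_pXn2r ?nnegrE ?form_norm_ge0 // ?(ltW eta0) //.
    by have /negP := h n; rewrite -ltNge => /ltW.
  have [x Dx lx] := lD n.
  have Ml : M (l n).
    rewrite lx; apply: real_linearB => //; first exact: TM.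
    by apply: real_linearZ => //; exact: DM.
  have h1 : nrm (K y) <= nrm (K (l n)) + nrm (K (y - l n)).
    by rewrite (solution_sub hK) // -{1}[K y](subrKC (K (l n))) form_norm_triangle.
  have h2 : nrm (K (l n)) <= c * nrm (l n) by rewrite lx; exact: contraction.
  have [_ _ h3] := hKM _ (real_linearB Mlin My Ml).
  have h4 : nrm (l n) <= nrm y + nrm (l n - y).
    by rewrite -{1}[l n](subrKC y) form_norm_triangle.
  rewrite (form_norm_distC sP) in h3.
  have h5 : c * nrm (l n) <= c * (nrm y + nrm (l n - y)) by rewrite ler_pM2l.
  have h6 : (c + C) * nrm (l n - y) <= e.
    by rewrite mulrC -ler_pdivlMr // addr_gt0.
  lra.
have -> : a + delta = (a - eps) + c^-1 by rewrite invrK; ring.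
apply: (bound_improvement c0) => [x Dx|x Dx].
  by exists (K x); have [Dk Tk _] := hKM _ (DM Dx); split=> //; exact/Kc/DM.
apply: le_trans (Ta x Dx); rewrite ler_wpM2r ?form_ge0 //.
by rewrite lerBlDr lerDl ltW.
Qed.

End SymmetricOperator.

(** * The complex scalar product *)

Section ScalarProduct.
Variables (R : realType) (H : completeNormedModType R[i]).
Variable dot : {dot H for Num.conj}.
Local Notation "<| x , y |>" := (scalar_product dot x y).

Lemma scalar_productC x y : <|x, y|> = (<|y, x|>)^*.
Proof. by rewrite /scalar_product hermC mul1r. Qed.
Lemma scalar_productDr x y z : <|x, y + z|> = <|x, y|> + <|x, z|>.
Proof. by rewrite /scalar_product linearDl. Qed.
Lemma scalar_productZr a x y : <|x, a *: y|> = a * <|x, y|>.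
Proof. by rewrite /scalar_product linearZl_LR. Qed.
Lemma scalar_productZl a x y : <|a *: y, x|> = a^* * <|y, x|>.
Proof. by rewrite scalar_productC scalar_productZr rmorphM /= -scalar_productC. Qed.
Lemma scalar_product0r x : <|x, 0|> = 0.
Proof. by rewrite /scalar_product linear0l. Qed.
Lemma scalar_productNr x y : <|x, - y|> = - <|x, y|>.
Proof. by rewrite /scalar_product linearNl. Qed.
Lemma scalar_product_sumr (I : finType) (P : pred I) (x : H) (F : I -> H) :
  <|x, \sum_(i | P i) F i|> = \sum_(i | P i) <|x, F i|>.
Proof.
by apply: (big_morph (fun y => <|x, y|>)) => [y z|];
  [exact: scalar_productDr|exact: scalar_product0r].
Qed.

Definition re_product (x y : H) : R := complex.Re <|x, y|>.
Local Notation rd := re_product.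
Local Notation nrm := (form_norm rd).

Lemma re_product_form : real_form rd.
Proof.
split=> [x y|x y z|a x y|x].
- by rewrite /rd scalar_productC; case: <|y, x|>.
- by rewrite /rd scalar_productDr raddfD.
- by rewrite /rd scalar_productZr; case: <|x, y|> => u v /=; rewrite mul0r subr0.
- by have := dnorm_ge0 dot x; rewrite lecE => /andP[].
Qed.

Lemma scalar_product_self x : <|x, x|> = (rd x x)%:C.
Proof.
have : 0 <= <|x, x|> by exact: dnorm_ge0.
by rewrite /rd lecE; case: <|x, x|> => a b /= /andP[/eqP -> _].
Qed.

Lemma re_product_definite x : rd x x = 0 -> x = 0.
Proof.
move=> x0; apply/eqP; rewrite -(dnorm_eq0 dot).
by have := scalar_product_self x; rewrite /scalar_product x0 => ->.
Qed.

(** Conjugate linearity in the first argument turns the imaginary part into a real part, so that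
    estimates for [re_product] suffice. *)
Lemma scalar_product_re x y : <|x, y|> = rd x y +i* rd ('i%C *: x) y.
Proof.
rewrite /rd scalar_productZl; case: <|x, y|> => a b /=; congr (_ +i* _); ring.
Qed.

Lemma scalar_product_ext x y :
  (forall v, <|v, x|> = <|v, y|>) -> x = y.
Proof.
move=> h; apply/eqP; rewrite -subr_eq0; apply/eqP/re_product_definite.
by rewrite /rd scalar_productDr scalar_productNr h subrr.
Qed.

Lemma nrm_i x : nrm ('i%C *: x) = nrm x.
Proof.
rewrite /form_norm /rd scalar_productZl scalar_productZr mulrA; congr (Num.sqrt (complex.Re _)).
by rewrite -[RHS]mul1r; congr (_ * _); apply/eqP; rewrite eq_complex /=; apply/andP; split; apply/eqP; ring.
Qed.

(* Real-valued substitute for the modulus, which in [R[i]] is a complex number. *)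
Definition abs1 (z : R[i]) : R := `|complex.Re z| + `|complex.Im z|.

Lemma abs1_ge0 z : 0 <= abs1 z. Proof. by rewrite addr_ge0. Qed.
Lemma abs1_eq0 z : abs1 z <= 0 -> z = 0.
Proof.
case: z => a b; rewrite /abs1 /= => h; apply/eqP; rewrite eq_complex /=.
have := normr_ge0 a; have := normr_ge0 b => hb ha.
by apply/andP; split; rewrite -normr_eq0; apply/eqP; lra.
Qed.
Lemma abs1D z w : abs1 (z + w) <= abs1 z + abs1 w.
Proof.
case: z w => [a b] [c d]; rewrite /abs1 /=.
by have := ler_normD a c; have := ler_normD b d; lra.
Qed.
Lemma abs1M z w : abs1 (z * w) <= abs1 z * abs1 w.
Proof.
case: z w => [a b] [c d]; rewrite /abs1 /= mulrDl !mulrDr -!normrM.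
by have := ler_normB (a * c) (b * d); have := ler_normD (a * d) (b * c); lra.
Qed.
Lemma abs1N z : abs1 (- z) = abs1 z.
Proof. by case: z => a b; rewrite /abs1 /= !normrN. Qed.
Lemma abs1J z : abs1 z^* = abs1 z.
Proof. by case: z => a b; rewrite /abs1 /= normrN. Qed.
Lemma Re_le_abs1 z : complex.Re z <= abs1 z.
Proof. by rewrite /abs1 ler_wpDr // ler_norm. Qed.
Lemma abs1_sum (I : finType) (P : pred I) (F : I -> R[i]) :
  abs1 (\sum_(i | P i) F i) <= \sum_(i | P i) abs1 (F i).
Proof.
apply: (big_ind2 (fun z a => abs1 z <= a)) => // [|z a w b za wb].
  by rewrite /abs1 /= normr0 addr0.
by rewrite (le_trans (abs1D _ _)) // lerD.
Qed.

Lemma abs1_scalar_product x y : abs1 <|x, y|> <= 2 * (nrm x * nrm y).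
Proof.
rewrite scalar_product_re /abs1 /=.
have := form_Cauchy_Schwarz re_product_form x y.
by have := form_Cauchy_Schwarz re_product_form ('i%C *: x) y; rewrite nrm_i; lra.
Qed.

Lemma form_norm_scale a x : nrm (a *: x) <= abs1 a * nrm x.
Proof.
rewrite [a in X in X <= _]complexE scalerDl mulrC -scalerA.
apply: le_trans (form_norm_triangle re_product_form _ _) _.
rewrite form_normZ; last exact: re_product_form.
rewrite form_normZ; last exact: re_product_form.
by rewrite nrm_i -mulrDl mulrC.
Qed.

Hypothesis norm_dot : forall x : H, `|x| ^+ 2 = <|x, x|>.

Lemma norm_form_norm (x : H) : `|x| = (nrm x)%:C.
Proof.
apply/eqP; rewrite -(@eqrXn2 _ 2) //; last by rewrite lecR form_norm_ge0.
by rewrite norm_dot scalar_product_self -rmorphXn /= form_norm_sqr //; exact: re_product_form.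
Qed.

Lemma cvg_form_norm (u : nat -> H) (l : H) :
  u n @[n --> \oo] --> l <-> nrm (u n - l) @[n --> \oo] --> (0 : R).
Proof.
split=> [/cvgrPdist_lt h|h].
  apply/cvgrPdist_lt => e e0; have e0' : 0 < e%:C by rewrite ltcR.
  apply: filterS (h _ e0') => n /=.
  rewrite norm_form_norm ltcR sub0r normrN ger0_norm ?form_norm_ge0 //.
  by rewrite form_norm_distC //; exact: re_product_form.
apply/cvgrPdist_lt => e; rewrite ltcE => /andP[/eqP ei e0].
move/cvgrPdist_lt: h => /(_ _ e0); apply: filterS => n /=.
rewrite norm_form_norm sub0r normrN ger0_norm ?form_norm_ge0 //.
rewrite form_norm_distC; last exact: re_product_form.
by rewrite ltcE /= ei eqxx.
Qed.

Lemma near_harmonic (e : R) : 0 < e -> \forall n \near \oo, n.+1%:R^-1 < e.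
Proof.
move=> e0; have /cvgrPdist_lt/(_ _ e0) := @cvg_harmonic R.
by apply: filterS => n; rewrite /harmonic /= sub0r normrN ger0_norm // invr_ge0.
Qed.

Lemma re_product_complete : complete_for rd setT.
Proof.
move=> u _ uc.
have sP := re_product_form.
have nrm2 n p : nrm (u n - u p) ^+ 2 <= 2 * n.+1%:R^-1 + 2 * p.+1%:R^-1.
  by rewrite form_norm_sqr.
have cu : cvg (u n @[n --> \oo]).
  apply: cauchy_cvg; apply: cauchy_exP => e; rewrite ltcE => /andP[/eqP /= ei e0].
  have e2 : 0 < complex.Re e ^+ 2 / 4 by rewrite divr_gt0 ?exprn_gt0.
  have [N _ hN] := near_harmonic e2.
  exists (u N); exists N => // n Nn.
  rewrite /= -ball_normE /ball_ /= norm_form_norm ltcE /= ei eqxx /=.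
  rewrite -(@ltr_pXn2r _ 2) ?nnegrE ?form_norm_ge0 ?(ltW e0) //.
  by have := hN N (leqnn N); have := hN n Nn; have := nrm2 N n => /=;
    move: (N.+1%:R^-1) (n.+1%:R^-1) => a b; lra.
exists (lim (u n @[n --> \oo])) => // n; set l := lim _.
have ul : nrm (u p - l) @[p --> \oo] --> (0 : R) by apply/cvg_form_norm.
apply/ler_addgt0Pr => e e0.
(* Error budget: the tail [2 * p.+1%:R^-1] takes [e / 2], and the terms with [u p - l] take at most
   five times its norm; the cap [1] makes the square of this norm at most the norm. *)
have e3 : 0 < Num.min 1 (e / 10) by rewrite lt_min ltr01 divr_gt0.
have e4 : 0 < e / 4 by rewrite divr_gt0.
move/cvgrPdist_lt: ul => /(_ _ e3) ul.
near \oo => p.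
have : nrm (u p - l) < Num.min 1 (e / 10).
  rewrite -[ltLHS]ger0_norm ?form_norm_ge0 // -normrN -sub0r.
  by near: p.
rewrite lt_min => /andP[b1 be].
have pe : p.+1%:R^-1 < e / 4 by near: p; exact: near_harmonic.
have n1 : n.+1%:R^-1 <= 1 :> R by rewrite invf_le1 // ler1n.
have p1 : p.+1%:R^-1 <= 1 :> R by rewrite invf_le1 // ler1n.
have np2 : nrm (u n - u p) <= 2.
  rewrite -(@ler_pXn2r _ 2) ?nnegrE ?form_norm_ge0 //.
  apply: le_trans (nrm2 n p) _; move: n1 p1.
  by move: (n.+1%:R^-1) (p.+1%:R^-1) => a b; lra.
have -> : rd (u n - l) (u n - l) = rd (u n - u p) (u n - u p)
    + 2 * rd (u n - u p) (u p - l) + rd (u p - l) (u p - l).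
  by rewrite !(formE sP) (form_sym sP (u p) (u n)) !(form_sym sP l); ring.
have h1 := uc n p.
have h2 := form_le_norm sP (u n - u p) (u p - l).
have b0 := form_norm_ge0 rd (u p - l).
have h3 : nrm (u n - u p) * nrm (u p - l) <= 2 * nrm (u p - l).
  by rewrite ler_wpM2r.
have h4 : rd (u p - l) (u p - l) <= nrm (u p - l).
  by rewrite -(form_norm_sqr sP) expr2 ler_piMr // ltW.
move: h1 pe; move: (n.+1%:R^-1) (p.+1%:R^-1) => a b; lra.
Unshelve. all: by end_near.
Qed.

Lemma continuous_linear_bound (S : {linear H -> H}) : continuous S ->
  exists2 C, 0 < C & forall x, nrm (S x) <= C * nrm x.
Proof.
move=> /linear_bounded_continuous/linear_boundedP Sb.
have [M M0 hM] := pinfty_ex_gt0 Sb.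
move: M0; rewrite ltcE => /andP[/eqP /= M1 M0].
exists (complex.Re M) => // x.
have := hM x; rewrite /= !norm_form_norm lecE => /andP[_].
by case: M M1 {hM M0} => a b /= ->; rewrite ?mulr0 ?mul0r ?subr0.
Qed.

End ScalarProduct.

(** * Linear independence and dimension *)

Section LinearAlgebra.
Variables (R : realType) (H : lmodType R[i]).

Definition linear_set (L : set H) :=
  L 0 /\ forall (a : R[i]) x y, L x -> L y -> L (a *: x + y).

(** [lin_indep] over an arbitrary finite index type, so that families can be joined over sums of
    types. *)
Definition free_family (I : finType) (b : I -> H) :=
  forall c : I -> R[i], \sum_i c i *: b i = 0 -> forall i, c i = 0.

Lemma linear_set_real (L : set H) : linear_set L -> real_linear L.
Proof. by case=> L0 LZ; split=> // a x y; exact: LZ. Qed.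

Lemma linear_set_sum (L : set H) (I : finType) (P : pred I) (F : I -> H) :
  linear_set L -> (forall i, P i -> L (F i)) -> L (\sum_(i | P i) F i).
Proof.
move=> [L0 LZ] LF; apply: big_ind => // x y Lx Ly.
by rewrite -[x]scale1r; exact: LZ.
Qed.

Lemma linear_setZ (L : set H) a x : linear_set L -> L x -> L (a *: x).
Proof. by move=> [L0 LZ] Lx; rewrite -[_ *: _]addr0; exact: LZ. Qed.

Lemma linear_setB (L : set H) x y : linear_set L -> L x -> L y -> L (x - y).
Proof. by move=> [L0 LZ] Lx Ly; rewrite addrC -scaleN1r; exact: LZ. Qed.

Lemma linear_setI (L M : set H) : linear_set L -> linear_set M ->
  linear_set (L `&` M).
Proof.
move=> [L0 LZ] [M0 MZ]; split=> // a x y [Lx Mx] [Ly My].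
by split; [exact: LZ|exact: MZ].
Qed.

Lemma linear_span_linear (A : set H) : linear_set (linear_span A).
Proof.
split.
  exists 0%N, (fun=> 0), (fun=> 0); split; first by case.
  by rewrite big_ord0.
move=> a _ _ [d1 [b1 [c1 [A1 ->]]]] [d2 [b2 [c2 [A2 ->]]]].
exists (d1 + d2)%N.
exists (fun i : 'I_(d1 + d2) => match fintype.split i with inl j => b1 j | inr j => b2 j end).
exists (fun i : 'I_(d1 + d2) => match fintype.split i with inl j => a * c1 j | inr j => c2 j end).
split; first by move=> i; case: fintype.split.
rewrite big_split_ord /= scaler_sumr; congr (_ + _); apply: eq_bigr => i _.
  by rewrite (unsplitK (inl i)) scalerA.
by rewrite (unsplitK (inr i)).
Qed.

Lemma linear_span_sub (A L : set H) : linear_set L -> A `<=` L ->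
  linear_span A `<=` L.
Proof.
move=> Llin AL _ [d [b [c [Ab ->]]]].
by apply: linear_set_sum => // i _; apply: linear_setZ => //; exact/AL/Ab.
Qed.

Lemma linear_span_gen (A : set H) : A `<=` linear_span A.
Proof.
move=> x Ax; exists 1%N, (fun=> x), (fun=> 1); split => //.
by rewrite big_ord1 scale1r.
Qed.

Lemma linear_span_rangeP d (b : 'I_d -> H) x :
  linear_span (range b) x <-> exists c : 'I_d -> R[i], x = \sum_i c i *: b i.
Proof.
split=> [|[c ->]]; last by exists d, b, c; split=> // i; exists i.
pose L : set H := [set x | exists c : 'I_d -> R[i], x = \sum_i c i *: b i].
suff h : linear_span (range b) `<=` L by move=> /h.
apply: linear_span_sub.
  split; first by exists (fun=> 0); rewrite big1 // => i _; rewrite scale0r.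
  move=> a _ _ [c ->] [c' ->]; exists (fun i => a * c i + c' i).
  rewrite scaler_sumr -big_split /=; apply: eq_bigr => i _.
  by rewrite scalerDl scalerA.
move=> _ [i _ <-]; exists (fun j => (j == i)%:R).
rewrite (bigD1 i) //= eqxx scale1r big1 ?addr0 // => j /negPf ->.
by rewrite scale0r.
Qed.

(** A nonzero row vector in the kernel of the coefficient matrix would be a linear relation between
    the [u i]; so the matrix has full row rank, which is at most its number of columns. *)
Lemma free_family_card (I : finType) (u : I -> H) d (b : 'I_d -> H) :
  free_family u -> (forall i, linear_span (range b) (u i)) -> (#|I| <= d)%N.
Proof.
move=> uf ub.
have /choice[A hA] : forall i, exists c : 'I_d -> R[i], u i = \sum_j c j *: b j.
  by move=> i; exact/linear_span_rangeP.
pose M : 'M[R[i]]_(#|I|, d) := \matrix_(i, j) A (enum_val i) j.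
suff : row_free M by rewrite /row_free => /eqP <-; exact: rank_leq_col.
apply/row_freeP; apply: contrapT => nf.
have : kermx M != 0 by apply: contra_notN nf; rewrite kermx_eq0 => /row_freeP.
move=> /rowV0Pn[v /sub_kermxP vM v0].
suff v00 : v = 0 by rewrite v00 eqxx in v0.
apply/rowP => k; rewrite mxE.
have := uf (fun i => v 0 (enum_rank i)) _ (enum_val k); rewrite enum_valK; apply.
rewrite (reindex_onto enum_val enum_rank) /=; last by move=> i _; exact: enum_rankK.
rewrite (eq_bigl xpredT); last by move=> i; rewrite enum_valK eqxx.
under eq_bigr do rewrite enum_valK hA scaler_sumr.
rewrite exchange_big big1 //= => j _.
under eq_bigr do rewrite scalerA.
rewrite -scaler_suml.
have := congr1 (fun N : 'rV_d => N 0 j) vM; rewrite !mxE => h.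
rewrite [X in X *: _](_ : _ = 0) ?scale0r // -[RHS]h.
by apply: eq_bigr => i _; rewrite mxE.
Qed.

Lemma has_dim_card (V : set H) d p (u : 'I_p -> H) :
  has_dim V d -> lin_indep u -> (forall i, V (u i)) -> (p <= d)%N.
Proof.
move=> [b [_ ->]] uf uV.
by have := @free_family_card _ u d b uf uV; rewrite card_ord.
Qed.

Lemma has_dim_linear (V : set H) d : has_dim V d -> linear_set V.
Proof. by move=> [b [_ ->]]; exact: linear_span_linear. Qed.

(** A free family of maximal size spans: adjoining [x] creates a nontrivial relation, in which the
    coefficient of [x] cannot vanish. *)
Lemma has_dim_exists (L : set H) (d : nat) : linear_set L ->
  (forall p (u : 'I_p -> H), lin_indep u -> (forall i, L (u i)) -> (p <= d)%N) ->
  exists e, has_dim L e.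
Proof.
move=> Llin Lb.
pose P e := `[< exists u : 'I_e -> H, lin_indep u /\ forall i, L (u i) >].
have P0 : exists e, P e.
  exists 0%N; apply/asboolP; exists (fun=> 0); split => [c _|]; by case.
have Pb e : P e -> (e <= d)%N by move=> /asboolP[u [uf uL]]; exact: Lb uf uL.
have [e /asboolP[u [uf uL]] emax] := ex_maxnP P0 Pb.
exists e, u; split => //; apply/seteqP; split => [x Lx|]; last first.
  by apply: linear_span_sub => // _ [i _ <-].
apply/linear_span_rangeP.
pose w (i : 'I_e.+1) := oapp u x (unlift ord0 i).
have : ~ lin_indep w.
  move=> wf; suff : (e.+1 <= e)%N by rewrite ltnn.
  apply: emax; apply/asboolP; exists w; split => // i.
  by rewrite /w; case: unlift => [j|//]; exact: uL.
move=> /existsNP[c /not_implyP[]].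
rewrite big_ord_recl {1}/w unlift_none /=.
under eq_bigr do rewrite /w liftK /=.
move=> cw /existsNP[i0 ci0].
have [c0|c0] := eqVneq (c ord0) 0.
  exfalso; apply: ci0; move: cw; rewrite c0 scale0r add0r => /uf h.
  by case: (unliftP ord0 i0) => [j ->|-> //]; exact: h.
exists (fun i => - (c ord0)^-1 * c (lift ord0 i)).
move/eqP: cw; rewrite addr_eq0 => /eqP cw.
rewrite -[LHS]scale1r -(mulVf c0) -scalerA cw scalerN scaler_sumr -sumrN.
by apply: eq_bigr => i _; rewrite mulNr scaleNr scalerA.
Qed.

(* The matrix is made singular by keeping column [k] zero. *)
Lemma exists_annihilated m (k : 'I_m) (a : 'I_m -> 'I_m -> R[i]) :
  exists c : 'I_m -> R[i], [/\ exists i, c i != 0,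
    forall i : 'I_m, (k < i)%N -> c i = 0
  & forall j : 'I_m, (j < k)%N -> \sum_i c i * a j i = 0].
Proof.
(* Rows beyond [k] are those of the identity and force the later coefficients of a left kernel
   vector to vanish; the columns before [k] carry the conditions. *)
pose N : 'M[R[i]]_m := \matrix_(i, j)
  if (i <= k)%N then (if (j < k)%N then a j i else 0) else (i == j)%:R.
have Nk : N *m delta_mx k (ord0 : 'I_1) = 0.
  apply/matrixP => i j; rewrite -colE !mxE ltnn; case: leqP => // ki.
  by rewrite -val_eqE gtn_eqF.
have nf : ~~ row_free N.
  apply/negP => Nf.
  have Nu : N \in unitmx by rewrite -row_free_unit.
  have := congr1 (fun M : 'cV_m => (invmx N *m M) k 0) Nk.
  rewrite mulKmx // mulmx0 !mxE !eqxx => /eqP.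
  by rewrite oner_eq0.
have : kermx N != 0 by rewrite kermx_eq0.
move=> /rowV0Pn[v /sub_kermxP vN v0].
have vj j : \sum_i v 0 i * N i j = 0.
  by have := congr1 (fun M : 'rV_m => M 0 j) vN; rewrite !mxE.
have big (i : 'I_m) : (k < i)%N -> v 0 i = 0.
  move=> ki; rewrite -[RHS](vj i) (bigD1 i) //= mxE leqNgt ki /= eqxx mulr1.
  rewrite big1 ?addr0 // => j ji; rewrite mxE (negPf ji) [(i < k)%N]ltnNge (ltnW ki) /=.
  by case: ifP; rewrite mulr0.
exists (v 0); split => //.
  apply: contrapT => /forallNP h; move: v0; rewrite (_ : v = 0) ?eqxx //.
  by apply/rowP => i; rewrite mxE; have /negP := h i; rewrite negbK => /eqP.
move=> j jk; rewrite -[RHS](vj j); apply: eq_bigr => i _.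
rewrite mxE jk; case: leqP => // ki; by rewrite big // !mul0r.
Qed.

End LinearAlgebra.

(** * Dual bases, linear equations and choice of eigenvectors *)

Section FiniteDimensional.
Variables (R : realType) (H : completeNormedModType R[i]).
Variable dot : {dot H for Num.conj}.
Local Notation "<| x , y |>" := (scalar_product dot x y).
Local Notation rd := (re_product dot).
Local Notation nrm := (form_norm rd).

Lemma scalar_product_suml (I : finType) (P : pred I) (c : I -> R[i]) F x :
  <|\sum_(i | P i) c i *: F i, x|> = \sum_(i | P i) (c i)^* * <|F i, x|>.
Proof.
rewrite scalar_productC scalar_product_sumr rmorph_sum; apply: eq_bigr => i _.
by rewrite scalar_productZr rmorphM /= -scalar_productC.
Qed.

Lemma form_norm_sum (I : finType) (P : pred I) (F : I -> H) :
  nrm (\sum_(i | P i) F i) <= \sum_(i | P i) nrm (F i).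
Proof.
have sP := re_product_form dot.
apply: (big_ind2 (fun z a => nrm z <= a)) => // [|z a w b za wb].
  by rewrite /form_norm (form0r sP) sqrtr0.
by rewrite (le_trans (form_norm_triangle sP _ _)) // lerD.
Qed.

Lemma scalar_product_eq0 x : <|x, x|> = 0 -> x = 0.
Proof. by move=> x0; apply: (@re_product_definite _ _ dot); rewrite /re_product x0. Qed.

(** The Gram matrix is invertible, since a kernel vector gives a combination of the [b i] orthogonal
    to itself. Products with the [g i] read off coordinates and thereby bound them by the norm. *)
Lemma dual_basis d (b : 'I_d -> H) : lin_indep b ->
  exists2 g : 'I_d -> H, forall i, linear_span (range b) (g i)
    & forall k i, <|b k, g i|> = (k == i)%:R.
Proof.
move=> bf; pose G : 'M[R[i]]_d := \matrix_(j, k) <|b k, b j|>.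
have Gf : row_free G.
  apply: contraT => nG.
  have : kermx G != 0 by rewrite kermx_eq0.
  move=> /rowV0Pn[v /sub_kermxP vG v0].
  suff v00 : v = 0 by rewrite v00 eqxx in v0.
  apply/rowP => k; rewrite mxE; apply: (bf (v 0)).
  apply: scalar_product_eq0; rewrite {1}scalar_product_suml big1 // => j _.
  have := congr1 (fun M : 'rV_d => M 0 j) vG; rewrite !mxE => h.
  rewrite scalar_product_sumr [X in _ * X](_ : _ = 0) ?mulr0 // -[RHS]h.
  by apply: eq_bigr => i _; rewrite scalar_productZr mxE.

have NG' : invmx G *m G = 1%:M by rewrite mulVmx // -row_free_unit.
exists (fun i => \sum_j invmx G i j *: b j).
  by move=> i; apply/linear_span_rangeP; exists (invmx G i).
move=> k i; have := congr1 (fun M : 'M[R[i]]_d => M i k) NG'; rewrite !mxE eq_sym => <-.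
rewrite scalar_product_sumr; apply: eq_bigr => j _.
by rewrite scalar_productZr mxE.
Qed.

Definition linear_on (L : set H) (T : H -> H) :=
  forall (a : R[i]) x y, L x -> L y -> T (a *: x + y) = a *: T x + T y.

Lemma linear_on_sum (L : set H) T (I : finType) (c : I -> R[i]) (F : I -> H) :
  linear_set L -> linear_on L T -> (forall i, L (F i)) ->
  T (\sum_i c i *: F i) = \sum_i c i *: T (F i).
Proof.
move=> Llin Tlin LF.
have T0 : T 0 = 0.
  have := Tlin 1 0 0 Llin.1 Llin.1; rewrite !scale1r addr0 => h.
  by apply: (addrI (T 0)); rewrite -h addr0.
suff [_ ] : L (\sum_i c i *: F i) /\ T (\sum_i c i *: F i) = \sum_i c i *: T (F i).
  by [].
apply: (big_ind2 (fun x y => L x /\ T x = y)) => [|x y x' y' [Lx <-] [Lx' <-]|i _].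
- by split => //; exact: Llin.1.
- by have := Tlin 1 x x' Lx Lx'; have := Llin.2 1 x x' Lx Lx'; rewrite !scale1r.
- split; first exact: linear_setZ.
  by have := Tlin (c i) (F i) 0 (LF i) Llin.1; rewrite T0 !addr0.
Qed.

(** An injective endomorphism has an invertible matrix; the constant comes from the preimages [w j]
    of the basis vectors and from coordinates taken with the dual basis. *)
Lemma finite_dim_solve (L : set H) e (T : H -> H) : has_dim L e ->
  (forall x, L x -> L (T x)) -> linear_on L T ->
  (forall x, L x -> T x = 0 -> x = 0) ->
  exists2 C, 0 < C & forall y, L y -> exists z, [/\ L z, T z = y & nrm z <= C * nrm y].
Proof.
move=> Le LT Tlin ker; have Llin := has_dim_linear Le.
have [b [bf LE]] := Le.
have Lb i : L (b i) by rewrite LE; apply: linear_span_gen; exists i.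
have [g _ gb] := dual_basis bf.
have /choice[M hM] : forall i, exists c : 'I_e -> R[i], T (b i) = \sum_j c j *: b j.
  by move=> i; apply/linear_span_rangeP; rewrite -LE; exact: LT.
pose A : 'M[R[i]]_e := \matrix_(i, j) M i j.
have Af : row_free A.
  apply: contraT => nA.
  have : kermx A != 0 by rewrite kermx_eq0.
  move=> /rowV0Pn[v /sub_kermxP vA v0].
  suff v00 : v = 0 by rewrite v00 eqxx in v0.
  apply/rowP => k; rewrite mxE; apply: (bf (v 0)); apply: ker.
    by apply: linear_set_sum => // i _; exact: linear_setZ.
  rewrite (linear_on_sum _ Llin Tlin) //.
  under eq_bigr do rewrite hM scaler_sumr.
  rewrite exchange_big big1 //= => j _.
  under eq_bigr do rewrite scalerA.
  rewrite -scaler_suml [X in X *: _](_ : _ = 0) ?scale0r //.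
  have := congr1 (fun N : 'rV_e => N 0 j) vA; rewrite !mxE => h.
  by rewrite -[RHS]h; apply: eq_bigr => i _; rewrite mxE.
have NA : invmx A *m A = 1%:M by rewrite mulVmx // -row_free_unit.
pose w j := \sum_i invmx A j i *: b i.
have Lw j : L (w j) by apply: linear_set_sum => // i _; exact: linear_setZ.
have Tw j : T (w j) = b j.
  rewrite (linear_on_sum _ Llin Tlin) //.
  under eq_bigr do rewrite hM scaler_sumr.
  rewrite exchange_big (bigD1 j) //= [X in _ + X]big1 ?addr0 => [|k kj].
    under eq_bigr do rewrite scalerA.
    rewrite -scaler_suml [X in X *: _](_ : _ = 1) ?scale1r //.
    have := congr1 (fun N : 'M[R[i]]_e => N j j) NA; rewrite !mxE eqxx /= mulr1n => <-.
    by apply: eq_bigr => i _; rewrite mxE.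
  under eq_bigr do rewrite scalerA.
  rewrite -scaler_suml [X in X *: _](_ : _ = 0) ?scale0r //.
  have := congr1 (fun N : 'M[R[i]]_e => N j k) NA; rewrite !mxE eq_sym (negPf kj) /= mulr0n => h; rewrite -[RHS]h.
  by apply: eq_bigr => i _; rewrite mxE.
pose C := \sum_j 2 * nrm (g j) * nrm (w j).
have C0 : 0 <= C by apply: sumr_ge0 => j _; rewrite !mulr_ge0 ?form_norm_ge0.
exists (1 + C) => [|y Ly]; first by rewrite ltr_pwDl.
exists (\sum_j <|g j, y|> *: w j); split.
- by apply: linear_set_sum => // j _; exact: linear_setZ.
- rewrite (linear_on_sum _ Llin Tlin) //.
  under eq_bigr do rewrite Tw.
  move: Ly; rewrite LE => /linear_span_rangeP[c ->].
  apply: eq_bigr => j _; rewrite scalar_product_sumr (bigD1 j) //=.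
  rewrite big1 ?addr0 => [|k kj].
    by rewrite scalar_productZr scalar_productC gb eqxx rmorph_nat mulr1.
  by rewrite scalar_productZr scalar_productC gb (negPf kj) rmorph_nat mulr0.
- apply: le_trans (form_norm_sum _ _) _.
  apply: (@le_trans _ _ (C * nrm y)); last first.
    by rewrite ler_wpM2r ?form_norm_ge0 // lerDr.
  rewrite mulr_suml; apply: ler_sum => j _.
  apply: le_trans (form_norm_scale _ _ _) _.
  apply: (@le_trans _ _ (2 * (nrm (g j) * nrm y) * nrm (w j))).
    by rewrite ler_wpM2r ?form_norm_ge0 // abs1_scalar_product.
  by lra.
Qed.

(* [<x, sum (B - mu) c v>] is the square norm of [sum sqrt (B - mu) c v], as
   only pairs with equal eigenvalues contribute. *)
Lemma eigen_combination_le (I : finType) (v : I -> H) (mu : I -> R) (B : R)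
    (c : I -> R[i]) :
  (forall i j, mu i != mu j -> <|v i, v j|> = 0) ->
  (forall i, c i = 0 \/ mu i <= B) ->
  rd (\sum_i c i *: v i) (\sum_i (c i * (mu i)%:C) *: v i) <=
  B * rd (\sum_i c i *: v i) (\sum_i c i *: v i).
Proof.
move=> orth cB; have sP := re_product_form dot.
pose r i := (Num.sqrt (B - mu i))%:C.
pose d := \sum_i (c i * r i) *: v i.
set x := \sum_i c i *: v i; set y := \sum_i _.
suff h : rd x (B%:C *: x - y) = rd d d.
  by have := form_ge0 sP d; rewrite -h !(formE sP) subr_ge0.
congr complex.Re.
have -> : B%:C *: x - y = \sum_i (c i * (B - mu i)%:C) *: v i.
  rewrite scaler_sumr -sumrB; apply: eq_bigr => i _.
  by rewrite scalerA -scalerBl mulrC -mulrBr rmorphB.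
rewrite /d !scalar_product_suml; apply: eq_bigr => i _.
rewrite !scalar_product_sumr !mulr_sumr; apply: eq_bigr => j _.
rewrite !scalar_productZr.
have [mij|mij] := eqVneq (mu i) (mu j); last by rewrite orth // !mulr0.
case: (cB j) => [->|jB]; first by rewrite !mul0r !mulr0.
have rJ a : (a%:C)^* = a%:C :> R[i] by exact: conjc_real.
rewrite rmorphM /= /r mij rJ -!mulrA; congr (_ * _).
rewrite [RHS]mulrCA; congr (_ * _); rewrite mulrA -rmorphM /=.
by rewrite -expr2 sqr_sqrtr // subr_ge0.
Qed.

(** Each eigenspace has at least as many basis vectors as its value is listed, so distinct indices
    can receive distinct ones; across different values independence follows from orthogonality. *)
Lemma eigenvector_choice (D : set H) T (P : set R) m (lam : 'I_m -> R) :
  (forall (a b : R) x y, a != b -> eigenvectors D T a%:C x ->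
     eigenvectors D T b%:C y -> <|x, y|> = 0) ->
  initial_eigenvalues D T P lam ->
  exists2 v : 'I_m -> H, lin_indep v
    & forall k, eigenvectors D T (lam k)%:C (v k).
Proof.
move=> orth [_ _ hmul _].
have /choice[F hF] : forall k, exists F : 'I_m -> H,
    (forall j, eigenvectors D T (lam k)%:C (F j)) /\
    forall c : 'I_m -> R[i], \sum_(j | lam j == lam k) c j *: F j = 0 ->
      forall j, lam j == lam k -> c j = 0.
  move=> k; have [d [[b [bf bE]] le]] := hmul k.
  set C := [set j | lam j == lam k]%SET in le.
  have kC : k \in C by rewrite inE.
  pose f j := widen_ord le (enum_rank_in kC j).
  have f_inj : {in C &, injective f}.
    move=> i j iC jC /(congr1 val) /= fij.
    by apply: (enum_rank_in_inj (Ax0 := kC) (Ay0 := kC) iC jC); exact: val_inj.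
  exists (b \o f); split.
    by move=> j; rewrite bE; apply: linear_span_gen; exists (f j).
  move=> c; rewrite (partition_big f xpredT) //= => c0 j jk.
  pose c' i := \sum_(l | (lam l == lam k) && (f l == i)) c l.
  have <- : c' (f j) = c j.
    rewrite /c' (bigD1 j) ?jk ?eqxx //= big1 ?addr0 // => l.
    move=> /andP[/andP[lk /eqP fl] lj]; move/eqP: lj; case.
    by apply: f_inj; rewrite ?inE.
  apply: bf; rewrite -[RHS]c0; apply: eq_bigr => i _.
  by rewrite scaler_suml; apply: eq_bigr => l /andP[_ /eqP ->].
(* One representative index per value, so that all indices listing the same value draw from the same
   basis. *)
pose r k := odflt k [pick i | lam i == lam k].
have lam_r k : lam (r k) = lam k.
  by rewrite /r; case: pickP => [i /eqP|].
have r_eq j k : lam j = lam k -> r j = r k.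
  move=> jk; rewrite /r jk; case: pickP => // h.
  by have := h k; rewrite eqxx.
pose v j := F (r j) j.
have v_eig j : eigenvectors D T (lam j)%:C (v j).
  by rewrite -lam_r; exact: (hF (r j)).1.
exists v => // c c0 k.
(* The part of the vanishing combination that belongs to the value [lam k] is orthogonal to the
   rest, hence to itself. *)
pose z := \sum_(j | lam j == lam k) c j *: v j.
have z0 : z = 0.
  apply: scalar_product_eq0.
  have : <|z, \sum_j c j *: v j|> = 0 by rewrite c0 scalar_product0r.
  rewrite (bigID (fun j => lam j == lam k)) /= scalar_productDr.
  rewrite [X in _ + X](_ : _ = 0) ?addr0 // scalar_product_sumr big1 // => j jk.
  rewrite scalar_productZr [X in _ * X](_ : _ = 0) ?mulr0 //.
  rewrite scalar_product_suml big1 // => i /eqP ik.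
  by rewrite (orth (lam i) (lam j)) ?mulr0 // ik eq_sym.
apply: ((hF (r k)).2 c _ k); last by rewrite lam_r.
rewrite -[RHS]z0; apply: eq_big => [j|j /eqP jk]; first by rewrite lam_r.
by rewrite /v (r_eq j k) // jk lam_r.
Qed.

(** A nonzero [x] together with the [u j] for [j] in [C] would form [#|C| + 1] independent vectors
    of [V]. *)
Lemma orthogonal_complement_trivial (V : set H) m (C : {set 'I_m})
    (u : 'I_m -> H) x :
  has_dim V #|C| -> lin_indep u -> (forall j, j \in C -> V (u j)) ->
  V x -> (forall j, j \in C -> <|x, u j|> = 0) -> x = 0.
Proof.
move=> [b [_ VE]] uf uV Vx xu; apply/eqP; apply: contraT => x0.
pose w (i : unit + {j | j \in C}) :=
  match i with inl _ => x | inr j => u (val j) end.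
suff : (#|{: unit + {j | j \in C}}| <= #|C|)%N.
  by rewrite card_sum card_unit card_sig add1n ltnn.
apply: (@free_family_card _ _ _ w _ b); last first.
  by case=> [_|[j jC]] /=; rewrite -VE //; exact: uV.
move=> c; rewrite big_sumType /= (big_pred1 tt) => [c0|[]//].
have cx : c (inl tt) = 0.
  have : <|x, c (inl tt) *: x + \sum_i c (inr i) *: u (val i)|> = 0.
    by rewrite c0 scalar_product0r.
  rewrite scalar_productDr scalar_product_sumr big1 => [|[j jC] _].
    rewrite addr0 scalar_productZr => /eqP; rewrite mulf_eq0 => /orP[/eqP //|/eqP].
    by move=> /scalar_product_eq0 h; rewrite h eqxx in x0.
  by rewrite scalar_productZr /= xu ?mulr0.
move: c0; rewrite cx scale0r add0r => c0.
pose c' j := oapp (fun s => c (inr s)) 0 (insub j : option {j | j \in C}).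
have c'0 : forall j, c' j = 0.
  apply: uf; rewrite (bigID (mem C)) /= [X in _ + X]big1 ?addr0 => [|j jC].
    rewrite big_sub -[RHS]c0; apply: eq_bigr => s _.
    by rewrite /c' valK.
  by rewrite /c' insubN // scale0r.
case=> [[] //|s].
by have := c'0 (val s); rewrite /c' valK.
Qed.

End FiniteDimensional.

(** * Self-adjoint operators and their forms *)

Section SelfAdjoint.
Variables (R : realType) (H : completeNormedModType R[i]).
Variable dot : {dot H for Num.conj}.
Hypothesis norm_dot : forall x : H, `|x| ^+ 2 = scalar_product dot x x.
Local Notation "<| x , y |>" := (scalar_product dot x y).
Local Notation rd := (re_product dot).
Local Notation nrm := (form_norm rd).
Let rdP : real_form rd := re_product_form dot.

Lemma self_adjoint_dom (F : operator H) : self_adjoint dot F -> linear_set (dom F).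
Proof.
move=> Fsa; split; last exact: dom_linear.
suff [] : dom F 0 /\ F 0 = 0 by [].
apply/Fsa => x Dx.
by rewrite scalar_productC scalar_product0r [RHS]scalar_productC scalar_product0r.
Qed.

Lemma self_adjoint_sym (F : operator H) x y : self_adjoint dot F ->
  dom F x -> dom F y -> <|x, F y|> = <|F x, y|>.
Proof. by move=> Fsa Dx Dy; have [_ h] := Fsa x (F x); rewrite h. Qed.

(** Testing with real parts is enough, as the domain contains with [x] also its multiple by
    [- 'i]. *)
Lemma self_adjoint_re (F : operator H) y z : self_adjoint dot F ->
  (forall x, dom F x -> rd z x = rd y (F x)) -> dom F y /\ F y = z.
Proof.
move=> Fsa h; apply/Fsa => x Dx.
have Fi : F ((- 'i%C) *: x) = (- 'i%C) *: F x.
  have [F0 _] := self_adjoint_dom Fsa.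
  have h0 : F 0 = 0.
    have := op_linear 1 F0 F0; rewrite !scale1r addr0 => h0.
    by apply: (addrI (F 0)); rewrite -h0 addr0.
  by have := op_linear (- 'i%C) Dx F0; rewrite h0 !addr0.
have Di : dom F ((- 'i%C) *: x) by apply: linear_setZ => //; exact: self_adjoint_dom.
have imE u v : rd ('i%C *: u) v = rd u ((- 'i%C) *: v).
  rewrite /re_product scalar_productZl scalar_productZr; congr (complex.Re (_ * _)).
  by apply/eqP; rewrite eq_complex /= oppr0 !eqxx.
by rewrite !scalar_product_re h // imE h // Fi -imE.
Qed.

(* An element orthogonal to [dom A] for the graph scalar product of [B] is in
   the kernel of [1 + A]. *)
Lemma sqrt_graph_core (A B : operator H) x :
  self_adjoint dot A -> positive_operator dot A -> is_sqrt dot A B -> dom B x ->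
  exists u : nat -> H, [/\ forall n, dom A (u n),
    forall n, rd (u n - x) (u n - x) <= 2 * n.+1%:R^-1
  & forall n, rd (B (u n) - B x) (B (u n) - B x) <= 2 * n.+1%:R^-1].
Proof.
move=> Asa Apos [Bsa _ dB BB] Bx.
have AB y : dom A y -> dom B y /\ dom B (B y) by rewrite -dB.
(* With this product [(x, B x)] is projected on the graph of [B] over [dom A]; both components of
   the minimising sequence converge. *)
pose s (y z : (H * H)%type) := rd y.1 z.1 + rd y.2 z.2.
have sP : real_form s.
  split=> [y z|y z w|a y z|y]; rewrite /s.
  - by rewrite (form_sym rdP) [X in _ + X](form_sym rdP).
  - by rewrite !(formE rdP); ring.
  - by rewrite !(formE rdP); ring.
  - by rewrite addr_ge0 ?form_ge0.
pose L := [set (y, B y) | y in dom A].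
have Alin := self_adjoint_dom Asa; have Blin := self_adjoint_dom Bsa.
have B0 : B 0 = 0.
  have := op_linear 1 Blin.1 Blin.1; rewrite !scale1r addr0 => h0.
  by apply: (addrI (B 0)); rewrite -h0 addr0.
have Llin : real_linear L.
  split; first by exists 0; [exact: Alin.1|rewrite B0].
  move=> a _ _ [y Ay <-] [z Az <-]; exists (a%:C *: y + z); first exact: Alin.2.
  by rewrite op_linear; [|exact: (AB y Ay).1|exact: (AB z Az).1].
have [l [lL lc lo]] := approximate_projection sP (x, B x) Llin.
have /choice[u uP] : forall n, exists y, dom A y /\ l n = (y, B y).
  by move=> n; have [y Ay <-] := lL n; exists y.
have uA n : dom A (u n) := (uP n).1.
have uB n : dom B (u n) := (AB _ (uA n)).1.
have lE n : l n = (u n, B (u n)) := (uP n).2.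
have [p _ up] : exists2 p, setT p & forall n, rd (u n - p) (u n - p) <= 2 * n.+1%:R^-1.
  apply: (re_product_complete norm_dot) => // n k.
  apply: le_trans (lc n k); rewrite !lE /s /= lerDl; exact: form_ge0.
have [p' _ up'] : exists2 p, setT p &
    forall n, rd (B (u n) - p) (B (u n) - p) <= 2 * n.+1%:R^-1.
  apply: (re_product_complete norm_dot) => // n k.
  apply: le_trans (lc n k); rewrite !lE /s /= lerDr; exact: form_ge0.
have eq_limit (a b : R) (c : R) : 
    (forall n, (a - b) ^+ 2 <= n.+1%:R^-1 * c) -> a = b.
  move=> /le_harmonic0 h; apply/eqP; rewrite -subr_eq0 -sqrf_eq0 eq_le h.
  exact: sqr_ge0.
have cs y z w v n : rd y y <= 2 * n.+1%:R^-1 -> rd z z <= 2 * n.+1%:R^-1 ->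
    (rd y w + rd z v) ^+ 2 <= n.+1%:R^-1 * (4 * (rd w w + rd v v)).
  move=> hy hz.
  have h1 := form_Cauchy_Schwarz_sqr rdP y w.
  have h2 := form_Cauchy_Schwarz_sqr rdP z v.
  have h3 := ler_wpM2r (form_ge0 rdP w) hy.
  have h4 := ler_wpM2r (form_ge0 rdP v) hz.
  have := sqr_ge0 (rd y w - rd z v).
  move: h1 h2 h3 h4; move: (n.+1%:R^-1) => a; lra.
(* The graph of [B] is closed: the limits satisfy the adjoint relation against every [y] in
   [dom B]. *)
have [Bp Bpp] : dom B p /\ B p = p'.
  apply: (self_adjoint_re Bsa) => y By.
  apply: (eq_limit _ _ (4 * (rd y y + rd (B y) (B y)))) => n.
  have h : rd (B (u n)) y = rd (u n) (B y).
    by rewrite /re_product self_adjoint_sym.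
  have -> : rd p' y - rd p (B y) = - (rd (B (u n) - p') y + rd (p - u n) (B y)).
    by rewrite !(formE rdP) h; ring.
  rewrite sqrrN; apply: cs => //.
  by apply: le_trans (up n); rewrite !(formE rdP); lra.
subst p'.
have Br : dom B (x - p) by exact: linear_setB.
have BrE : B (x - p) = B x - B p.
  have := op_linear (-1) Bp Bx.
  by rewrite !scaleN1r ![- _ + _]addrC.
have orth v : dom A v -> rd v (x - p) + rd (B v) (B x - B p) = 0.
  move=> Av; apply: (eq_limit _ _ (10 * (rd v v + rd (B v) (B v)))) => n.
  have := lo _ (ex_intro2 _ _ v Av erefl) n; rewrite lE /s /=.
  have := cs (u n - p) (B (u n) - B p) v (B v) n (up n) (up' n).
  have -> : rd v (x - p) + rd (B v) (B x - B p) - 0 =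
    rd v (x - u n) + rd (B v) (B x - B (u n)) +
    (rd (u n - p) v + rd (B (u n) - B p) (B v)).
    by rewrite !(formE rdP) (form_sym rdP (u n)) (form_sym rdP p)
      (form_sym rdP (B (u n))) (form_sym rdP (B p)); ring.
  move: (rd v (x - u n) + _) (rd (u n - p) v + _) (n.+1%:R^-1) => i j k.
  by have := sqr_ge0 (i - j); lra.
(* For [r = x - p], the identity [<B v, B r> = <A v, r>] turns orthogonality into the adjoint
   relation for [A r = - r]; positivity of [A] then gives [r = 0]. *)
have [Ar ArE] : dom A (x - p) /\ A (x - p) = - (x - p).
  apply: (self_adjoint_re Asa) => v Av.
  have := orth v Av; rewrite -BrE.
  have -> : rd (B v) (B (x - p)) = rd (A v) (x - p).
    rewrite -(BB v Av) /re_product self_adjoint_sym //; exact: (AB v Av).2.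
  by rewrite (form_sym rdP (A v)) (form_sym rdP v) !(formNl rdP); lra.
have r0 : x - p = 0.
  apply: (@re_product_definite _ _ dot); apply/eqP; rewrite eq_le form_ge0 // andbT.
  have := Apos _ Ar; rewrite ArE lecE => /andP[_].
  by rewrite -/(rd _ _) (formNr rdP) oppr_ge0.
by move/eqP: r0; rewrite subr_eq0 => /eqP ->; exists u.
Qed.

Lemma cvg_re_product (u v : nat -> H) x y :
  nrm (u n - x) @[n --> \oo] --> (0 : R) -> nrm (v n - y) @[n --> \oo] --> (0 : R) ->
  rd (u n) (v n) @[n --> \oo] --> rd x y.
Proof.
move=> ux vy.
have h : (nrm (u n - x) * nrm (v n - y) + nrm (u n - x) * nrm y + nrm x * nrm (v n - y))
    @[n --> \oo] --> (0 * 0 + 0 * nrm y + nrm x * 0 : R).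
  by apply: cvgD; [apply: cvgD; [exact: cvgM|apply: cvgMr_tmp]|apply: cvgMl_tmp].
rewrite !(mul0r, mulr0, addr0) in h.
apply/cvgrPdist_le => e e0; move/cvgrPdist_le: h => /(_ e e0).
apply: filterS => n; rewrite sub0r normrN ger0_norm; last first.
  by rewrite !addr_ge0 // mulr_ge0 ?form_norm_ge0.
apply: le_trans.
have -> : rd x y - rd (u n) (v n) =
    - (rd (u n - x) (v n - y) + rd (u n - x) y + rd x (v n - y)).
  by rewrite !(formE rdP); ring.
rewrite normrN; apply: le_trans (ler_normD _ _) _; apply: lerD.
  by apply: le_trans (ler_normD _ _) _; apply: lerD; exact: form_Cauchy_Schwarz.
exact: form_Cauchy_Schwarz.
Qed.

End SelfAdjoint.

(** * Lower bounds on orthogonal complements of eigenvectors *)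

Section LowerBounds.
Variables (R : realType) (H : completeNormedModType R[i]).
Variable dot : {dot H for Num.conj}.
Hypothesis norm_dot : forall x : H, `|x| ^+ 2 = scalar_product dot x x.
Local Notation "<| x , y |>" := (scalar_product dot x y).
Local Notation rd := (re_product dot).
Local Notation nrm := (form_norm rd).
Let rdP : real_form rd := re_product_form dot.

Definition orthogonal_to m (X : 'I_m -> H) (J : pred 'I_m) : set H :=
  [set x | forall j, J j -> <|X j, x|> = 0].

Lemma orthogonal_to_linear m (X : 'I_m -> H) J : linear_set (orthogonal_to X J).
Proof.
split=> [j _|a x y hx hy j Jj]; first exact: scalar_product0r.
by rewrite scalar_productDr scalar_productZr hx // hy // mulr0 addr0.
Qed.

Lemma orthogonal_to_complete m (X : 'I_m -> H) J :
  complete_for rd (orthogonal_to X J).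
Proof.
move=> u uY uc; have [l _ ul] := re_product_complete norm_dot (fun=> I) uc.
exists l => // j Jj.
have re0 z : (forall n, rd z (u n) = 0) -> rd z l = 0.
  move=> zu; apply/eqP; rewrite -sqrf_eq0 eq_le sqr_ge0 andbT.
  apply: (@le_harmonic0 _ _ (2 * rd z z)) => n.
  have -> : rd z l = - rd z (u n - l) by rewrite !(formE rdP) zu; ring.
  rewrite sqrrN; apply: le_trans (form_Cauchy_Schwarz_sqr rdP _ _) _.
  have := ler_wpM2l (form_ge0 rdP z) (ul n).
  move: (n.+1%:R^-1) => a; lra.
rewrite scalar_product_re !re0 // => n; rewrite /re_product.
  by rewrite scalar_productZl uY // mulr0.
by rewrite uY.
Qed.

(** One factor [B] moves to the right, commutes with [S] and completes [B B = A], and [S A = F]. *)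
Lemma form_of_operatorE (F A B : operator H) (S : {linear H -> H}) x y :
  is_sqrt dot A B -> is_sgn dot F A B S -> dom B x -> dom F y ->
  <|B x, S (B y)|> = <|x, F y|>.
Proof.
move=> [Bsa _ dB BB] [_ [AF FE] _ SB] Bx Fy.
have Ay : dom A y by rewrite AF.
have [By BBy] : dom2 B y by rewrite dB.
have [BS BSE] := SB _ BBy.
by rewrite -(self_adjoint_sym Bsa Bx BS) BSE BB // FE.
Qed.

(** The approximants of [x] from the core are first corrected so as to lie in the orthogonal
    complement; the inequality on [dom F] then passes to the limit in the graph norm of [B]. *)
Lemma form_lower_extension (F A B : operator H) (S : {linear H -> H})
    m (X : 'I_m -> H) (J : pred 'I_m) (lam : R) :
  self_adjoint dot F -> is_abs dot F A -> is_sqrt dot A B -> is_sgn dot F A B S ->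
  lin_indep X -> (forall j, dom F (X j)) ->
  (forall x, dom F x -> orthogonal_to X J x -> lam * rd x x <= rd x (F x)) ->
  forall x, dom B x -> orthogonal_to X J x ->
    lam * rd x x <= rd (B x) (S (B x)).
Proof.
move=> Fsa [Asa Apos _ _] AB FS Xf XF hF x Bx Yx.
have [Bsa _ dB _] := AB; have [[Scont _] [AF _] _ _] := FS.
have [C C0 SC] := continuous_linear_bound norm_dot Scont.
have FB y : dom F y -> dom B y by rewrite -AF -dB => -[].
have Blin := self_adjoint_dom Bsa; have Flin := self_adjoint_dom Fsa.
have [u [uA ux Bux]] := sqrt_graph_core norm_dot Asa Apos AB Bx.
have [g gX Xg] := dual_basis dot Xf.
have Fg i : dom F (g i).
  by apply: (linear_span_sub Flin _ (gX i)) => _ [j _ <-].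
(* This correction restores orthogonality and stays in [dom F]. It tends to zero, also after
   applying [B], because [<X j, u n> = <X j, u n - x>]. *)
pose w n := \sum_(j | J j) <|X j, u n|> *: g j.
have Fw n : dom F (w n).
  by apply: linear_set_sum => // j _; exact: linear_setZ.
have Fu n : dom F (u n - w n) by apply: linear_setB => //; rewrite -AF.
have Yu n : orthogonal_to X J (u n - w n).
  move=> j Jj; rewrite scalar_productDr scalar_productNr scalar_product_sumr.
  rewrite (bigD1 j) //= big1 ?addr0 => [|i /andP[_ ij]].
    by rewrite scalar_productZr Xg eqxx mulr1 subrr.
  by rewrite scalar_productZr Xg eq_sym (negPf ij) mulr0.
have to0 (v : nat -> H) : (forall n, rd (v n) (v n) <= 2 * n.+1%:R^-1) ->
    nrm (v n) @[n --> \oo] --> (0 : R).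
  move=> hv; apply/cvgrPdist_lt => e e0.
  have e2 : 0 < e ^+ 2 / 2 by rewrite divr_gt0 ?exprn_gt0.
  apply: filterS (near_harmonic e2) => n hn.
  rewrite sub0r normrN ger0_norm ?form_norm_ge0 //.
  rewrite -(@ltr_pXn2r _ 2) ?nnegrE ?form_norm_ge0 ?(ltW e0) //.
  rewrite (form_norm_sqr rdP); have := hv n.
  by move: (n.+1%:R^-1) hn => a; lra.
have wle (T : H -> H) n : (forall c, T (\sum_(j | J j) c j *: g j) =
      \sum_(j | J j) c j *: T (g j)) ->
    nrm (T (w n)) <= nrm (u n - x) * \sum_(j | J j) 2 * nrm (X j) * nrm (T (g j)).
  move=> TE; rewrite TE mulr_sumr.
  apply: le_trans (form_norm_sum _ _ _) _; apply: ler_sum => j Jj.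
  apply: le_trans (form_norm_scale _ _ _) _.
  have -> : <|X j, u n|> = <|X j, u n - x|>.
    by rewrite scalar_productDr scalar_productNr Yx // subr0.
  apply: (@le_trans _ _ (2 * (nrm (X j) * nrm (u n - x)) * nrm (T (g j)))).
    by rewrite ler_wpM2r ?form_norm_ge0 // abs1_scalar_product.
  by lra.
have shift (T : H -> H) (y : H) :
    nrm (T (u n) - y) @[n --> \oo] --> (0 : R) ->
    (forall n, T (u n - w n) = T (u n) - T (w n)) ->
    (forall c, T (\sum_(j | J j) c j *: g j) = \sum_(j | J j) c j *: T (g j)) ->
    nrm (T (u n - w n) - y) @[n --> \oo] --> (0 : R).
  move=> Ty TB TE.
  pose K := \sum_(j | J j) 2 * nrm (X j) * nrm (T (g j)).
  have h : (nrm (T (u n) - y) + nrm (u n - x) * K) @[n --> \oo] --> (0 + 0 * K : R).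
    by apply: cvgD => //; apply: cvgMr_tmp; exact: to0.
  rewrite mul0r addr0 in h.
  apply: (squeeze_cvgr _ (cvg_cst 0) h); apply: nearW => n.
  rewrite form_norm_ge0 /= TB addrAC.
  apply: le_trans (form_norm_triangle rdP _ _) _.
  by rewrite (form_normN rdP) lerD2l; exact: wle.
have c1 : nrm ((u n - w n) - x) @[n --> \oo] --> (0 : R).
  by apply: (shift id) => //; exact: to0.
have Bsum c : B (\sum_(j | J j) c j *: g j) = \sum_(j | J j) c j *: B (g j).
  have Bl : linear_on (dom B) B by move=> a y z By Bz; exact: op_linear.
  have h := linear_on_sum (fun j => if J j then c j else 0) Blin Bl
    (fun j => FB _ (Fg j)).
  rewrite [RHS]big_mkcond [X in B X]big_mkcond /=.
  rewrite (eq_bigr (fun j => (if J j then c j else 0) *: g j)) => [|j _].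
    by rewrite h; apply: eq_bigr => j _; case: ifP => // _; rewrite scale0r.
  by case: ifP => // _; rewrite scale0r.
have c2 : nrm (B (u n - w n) - B x) @[n --> \oo] --> (0 : R).
  apply: shift => //; first exact: to0.
  move=> n; have := op_linear (-1) (FB _ (Fw n)) (FB (u n) _).
  by rewrite !scaleN1r ![- _ + _]addrC; apply; rewrite -AF.
have c3 : nrm (S (B (u n - w n)) - S (B x)) @[n --> \oo] --> (0 : R).
  have h : (C * nrm (B (u n - w n) - B x)) @[n --> \oo] --> (C * 0 : R).
    exact: cvgMl_tmp.
  rewrite mulr0 in h.
  apply: (squeeze_cvgr _ (cvg_cst 0) h); apply: nearW => n.
  by rewrite form_norm_ge0 /= -linearB SC.
have c4 := cvg_re_product c1 c1; have c5 := cvg_re_product c2 c3.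
have c6 : (lam * rd (u n - w n) (u n - w n)) @[n --> \oo] --> lam * rd x x.
  by apply: cvgM => //; exact: cvg_cst.
apply: (ler_cvg_to c6 c5); apply: nearW => n.
rewrite [leRHS]/re_product (form_of_operatorE AB FS) //; last exact: FB.
exact: hF.
Qed.

(** By symmetry the resolvent leaves the orthogonal complement of eigenvectors invariant. If [b]
    equals [lam j], injectivity of [F - b] makes [X j] zero and orthogonality trivial. *)
Lemma resolvent_regular (F : operator H) m (X : 'I_m -> H) (lam : 'I_m -> R)
    (J : pred 'I_m) (b : R) :
  self_adjoint dot F -> lin_indep X ->
  (forall k, dom F (X k) /\ F (X k) = (lam k)%:C *: X k) ->
  resolvent_set F b%:C ->
  regular_value rd (orthogonal_to X J) (dom F `&` orthogonal_to X J) F b.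
Proof.
move=> Fsa Xf XF [G [Gc GF FG]].
have [C C0 GC] := continuous_linear_bound norm_dot Gc.
exists C, G; split => // y Yy; have [Dy Fy] := GF y.
have FyE : F (G y) = b%:C *: G y + y by rewrite -[X in _ + X]Fy addrC subrK.
split => //; split => // j Jj; have [DX FX] := XF j.
have [bj|bj] := eqVneq b (lam j).
  have X0 : X j = 0 by have := FG _ DX; rewrite FX bj subrr linear0.
  by rewrite X0 scalar_productC scalar_product0r rmorph0.
have := self_adjoint_sym Fsa DX Dy.
rewrite FyE FX scalar_productDr Yy // addr0 scalar_productZr scalar_productZl.
move=> /eqP; rewrite -subr_eq0 -mulrBl mulf_eq0 => /orP[|/eqP //].
have -> : ((lam j)%:C^* : R[i]) = (lam j)%:C by exact: conjc_real.
by rewrite -rmorphB (inj_eq (@complexI R)) subr_eq0 (negPf bj).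
Qed.

Lemma symmetric_on_orthogonal (D : set H) (T : H -> H) m (X : 'I_m -> H)
    (lam : 'I_m -> R) (J : pred 'I_m) (M : set H) :
  linear_set D -> linear_on D T -> linear_set M -> D `<=` M ->
  (forall x, D x -> M (T x)) ->
  (forall x y, D x -> D y -> <|x, T y|> = <|T x, y|>) ->
  (forall k, J k -> D (X k) /\ T (X k) = (lam k)%:C *: X k) ->
  symmetric_on rd (M `&` orthogonal_to X J) (D `&` orthogonal_to X J) T.
Proof.
move=> Dlin Tlin Mlin DM TM Tsym XT.
have Ylin := orthogonal_to_linear X J.
split.
- exact/linear_set_real/linear_setI.
- by split; [exact/linear_set_real/linear_setI|move=> x [/DM]].
- move=> x [Dx Yx]; split; first exact: TM.
  move=> j Jj; have [DX TX] := XT j Jj.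
  by rewrite Tsym // TX scalar_productZl Yx // mulr0.
- by move=> a x y [Dx _] [Dy _]; exact: Tlin.
- by move=> x y [Dx _] [Dy _]; rewrite /re_product Tsym.
Qed.

Lemma spectral_lower_bound (F : operator H) m (X : 'I_m -> H) (lam : 'I_m -> R) k :
  self_adjoint dot F -> lower_semi_definite dot F -> lin_indep X ->
  initial_eigenvalues (dom F) F
    [set mu : R | discrete_spectrum F mu%:C /\
                  (mu%:E < inf_essential_spectrum F)%E] lam ->
  (forall k, dom F (X k) /\ F (X k) = (lam k)%:C *: X k) ->
  forall x, dom F x -> orthogonal_to X [pred j | lam j < lam k] x ->
    lam k * rd x x <= rd x (F x).
Proof.
move=> Fsa [_ [c hc]] Xf [_ lamP _ lam4] XF.
set J := [pred j | _].
have Flin := self_adjoint_dom Fsa.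
pose Y := orthogonal_to X J.
have sym : symmetric_on rd Y (dom F `&` Y) F.
  have := @symmetric_on_orthogonal (dom F) F m X lam J setT Flin.
  rewrite setTI; apply => //.
  - by move=> a x y Dx Dy; exact: op_linear.
  - by move=> x y Dx Dy; exact: self_adjoint_sym.
move=> x Dx Yx.
suff h : forall x, (dom F `&` Y) x -> lam k * rd x x <= rd x (F x) by exact: h.
clear x Dx Yx; apply: (inequality_induction (c := Num.min c (lam k))) => [x _|||a ca alk Ta].
- exact: form_ge0.
- by rewrite ge_min lexx orbT.
- move=> x [Dx Yx]; apply: (@le_trans _ _ (c * rd x x)).
    by rewrite ler_wpM2r ?form_ge0 // ge_min lexx.
  have := hc x Dx; rewrite norm_dot scalar_product_self -rmorphM /=.
  by rewrite lecE => /andP[_].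
have [ra|sa] := pselect (resolvent_set F a%:C).
  have [C [K [C0 hK]]] := resolvent_regular J Fsa Xf XF ra.
  exists C^-1; rewrite ?invr_gt0 //.
  apply: (bound_improvement rdP sym C0) => // y [Dy Yy].
  by exists (K y); exact: hK.
have ainf : (a%:E < inf_essential_spectrum F)%E.
  by apply: lt_trans (lamP k).2; rewrite lte_fin.
(* Otherwise [a] would be in the essential spectrum although it is below its infimum. *)
have da : discrete_spectrum F a%:C.
  apply: contrapT => nd; move: ainf; rewrite ltNge => /negP; apply.
  by apply: ereal_inf_lbound; exists a%:C.
have [[_ [V nV VE]] _ _] := da.
have [e e0 eV] : exists2 e : R, 0 < e & forall b : R, `|b - a| < e -> V b%:C.
  move: nV => /nbhs_ballP[e /= e0 eV].
  move: e0; rewrite ltcE => /andP[/eqP /= ei e0].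
  exists (complex.Re e) => // b ba; apply: eV.
  rewrite -ball_normE /ball_ /= -rmorphB normc_def /= expr0n addr0 sqrtr_sqr.
  by rewrite ltcE /= ei eqxx distrC.
exists e => //; apply: (isolated_bound rdP _ sym) => //.
- exact: re_product_definite.
- exact: orthogonal_to_complete.
- move=> b ba /eV Vb; apply: (resolvent_regular J Fsa Xf XF).
  apply: contrapT => sb.
  have : (V `&` (spectrum F : set R[i]^o)) b%:C by split.
  by rewrite VE /= => /complexI ba'; rewrite ba' eqxx in ba.
move=> x [Dx Yx] Fx.
(* Since [a < lam k], the list contains a full set of eigenvectors for [a], and [x] is orthogonal to
   all of them. *)
have aE : exists k, a < lam k by exists k.
have dimE := lam4 a (conj da ainf) aE.
apply: (orthogonal_complement_trivial (dot := dot) dimE Xf) => //.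
  by move=> j; rewrite inE => /eqP <-.
move=> j; rewrite inE => /eqP ja.
by rewrite scalar_productC Yx ?rmorph0 // /J /= ja.
Qed.

(** The same induction as for [F], with injectivity of [T - a] on the finite-dimensional complement
    in place of the resolvent: a kernel vector would be orthogonal to a full set of eigenvectors for
    [a]. *)
Lemma finite_spectral_lower_bound (L : set H) e (T : H -> H) m (v : 'I_m -> H)
    (mu : 'I_m -> R) (c : R) k :
  has_dim L e -> (forall x, L x -> L (T x)) -> linear_on L T ->
  (forall x y, L x -> L y -> <|x, T y|> = <|T x, y|>) ->
  (forall x, L x -> c * rd x x <= rd x (T x)) ->
  lin_indep v ->
  (forall k, eigenvectors L T (mu k)%:C (v k)) ->
  initial_eigenvalues L T [set a : R | is_eigenvalue L T a%:C] mu ->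
  forall x, L x -> orthogonal_to v [pred j | mu j < mu k] x ->
    mu k * rd x x <= rd x (T x).
Proof.
move=> Le LT Tlin Tsym Tc vf vT [_ _ _ mu4].
have Llin := has_dim_linear Le.
set J := [pred j | _]; pose Y := orthogonal_to v J.
have sym : symmetric_on rd (L `&` Y) (L `&` Y) T.
  by apply: (symmetric_on_orthogonal (lam := mu)) => // j _; exact: vT.
have LYlin : linear_set (L `&` Y).
  by apply: linear_setI => //; exact: orthogonal_to_linear.
have [d Ld] : exists d, has_dim (L `&` Y) d.
  apply: (has_dim_exists (d := e)) => // p u uf uL.
  by apply: has_dim_card Le uf _ => i; exact: (uL i).1.
move=> x Lx Yx.
suff h : forall x, (L `&` Y) x -> mu k * rd x x <= rd x (T x) by exact: h.
clear x Lx Yx; apply: (inequality_induction (c := Num.min c (mu k))) => [x _|||a ca amk Ta].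
- exact: form_ge0.
- by rewrite ge_min lexx orbT.
- move=> x [Lx _]; apply: le_trans (Tc x Lx).
  by rewrite ler_wpM2r ?form_ge0 // ge_min lexx.
have [C C0 hC] : exists2 C, 0 < C & forall y, (L `&` Y) y ->
    exists z, [/\ (L `&` Y) z, T z - a%:C *: z = y & nrm z <= C * nrm y].
  apply: (finite_dim_solve dot Ld (T := fun z => T z - a%:C *: z)).
  - move=> z LYz; apply: linear_setB => //; last exact: linear_setZ.
    by have [_ _ h _ _] := sym; exact: h.
  - move=> b y z [Ly _] [Lz _]; rewrite Tlin //.
    apply: (scalar_product_ext (dot := dot)) => w.
    by rewrite !(scalar_productDr, scalar_productNr, scalar_productZr); ring.
  - move=> z [Lz Yz] /eqP; rewrite subr_eq0 => /eqP Tz.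
    apply: contrapT => /eqP z0.
    have az : is_eigenvalue L T a%:C by exists z.
    have dimE := mu4 a az (ex_intro _ k amk).
    move/eqP: z0; apply; apply: (orthogonal_complement_trivial (dot := dot) dimE vf) => //.
      by move=> j; rewrite inE => /eqP <-.
    move=> j; rewrite inE => /eqP ja.
    by rewrite scalar_productC Yz ?rmorph0 // /J /= ja.
exists C^-1; rewrite ?invr_gt0 //.
apply: (bound_improvement rdP sym C0) => // y LYy.
have [z [LYz <- zC]] := hC y LYy.
by exists z; split => //; rewrite addrC subrK.
Qed.

End LowerBounds.

(** * Convergence of the Ritz values *)

Section RitzVectors.
Variables (R : realType) (H : completeNormedModType R[i]).
Variable dot : {dot H for Num.conj}.
Local Notation "<| x , y |>" := (scalar_product dot x y).
Local Notation rd := (re_product dot).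
Local Notation nrm := (form_norm rd).
Let rdP : real_form rd := re_product_form dot.

Lemma eigenvectors_orthogonal (L : set H) (T : H -> H) (a b : R) x y :
  (forall x y, L x -> L y -> <|x, T y|> = <|T x, y|>) -> a != b ->
  eigenvectors L T a%:C x -> eigenvectors L T b%:C y -> <|x, y|> = 0.
Proof.
move=> Tsym ab [Lx Tx] [Ly Ty].
have /eqP := Tsym x y Lx Ly.
rewrite Tx Ty scalar_productZr scalar_productZl.
have -> : ((a%:C)^* : R[i]) = a%:C by exact: conjc_real.
rewrite -subr_eq0 -mulrBl mulf_eq0 => /orP[|/eqP //].
by rewrite -rmorphB (inj_eq (@complexI R)) subr_eq0 eq_sym (negPf ab).
Qed.

Lemma scalar_product_sum2 (I : finType) (c : I -> R[i]) (x y : I -> H) :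
  <|\sum_i c i *: x i, \sum_j c j *: y j|> =
  \sum_i \sum_j (c i)^* * (c j * <|x i, y j|>).
Proof.
rewrite scalar_product_suml; apply: eq_bigr => i _.
by rewrite scalar_product_sumr mulr_sumr; apply: eq_bigr => j _; rewrite scalar_productZr.
Qed.

Lemma sesquilinear_perturbation (I : finType) (c : I -> R[i])
    (alpha beta : I -> I -> R[i]) (eta : R) :
  (forall i j, abs1 (alpha i j - beta i j) <= eta) ->
  complex.Re (\sum_i \sum_j (c i)^* * (c j * alpha i j)) <=
  complex.Re (\sum_i \sum_j (c i)^* * (c j * beta i j)) +
  eta * (\sum_i abs1 (c i)) ^+ 2.
Proof.
move=> h; rewrite -lerBlDl -raddfB -sumrB /=.
apply: le_trans (Re_le_abs1 _) _; apply: le_trans (abs1_sum _ _) _.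
rewrite expr2 mulrA mulr_sumr; apply: ler_sum => i _.
rewrite -sumrB mulrAC mulr_sumr; apply: le_trans (abs1_sum _ _) _.
apply: ler_sum => j _; rewrite -!mulrBr.
apply: le_trans (abs1M _ _) _; rewrite abs1J -mulrA mulrCA.
rewrite ler_wpM2l ?abs1_ge0 // mulrC (le_trans (abs1M _ _)) //.
by rewrite ler_wpM2r ?abs1_ge0.
Qed.

(** The dual basis of [X] reads off the [c i]; replacing [X j] by [Xs j n] changes the vector by at
    most [(2 * G)^-1] times the sum of the [abs1 (c j)], and half of that sum is absorbed on the
    left. *)
Lemma coefficient_bound m (X : 'I_m -> H) (Xs : 'I_m -> nat -> H) :
  lin_indep X ->
  (forall k, nrm (Xs k n - X k) @[n --> \oo] --> (0 : R)) ->
  exists2 G, 0 < G & \forall n \near \oo, forall c : 'I_m -> R[i],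
    \sum_i abs1 (c i) <= G * nrm (\sum_i c i *: Xs i n).
Proof.
move=> Xf Xlim; have [g _ Xg] := dual_basis dot Xf.
pose G := 1 + \sum_i 2 * nrm (g i).
have G0 : 0 < G.
  by rewrite ltr_pwDl // sumr_ge0 // => i _; rewrite mulr_ge0 ?form_norm_ge0.
exists (2 * G); first by rewrite mulr_gt0.
have G1 : 0 < (2 * G)^-1 by rewrite invr_gt0 mulr_gt0.
have near1 : \forall n \near \oo, forall k, nrm (Xs k n - X k) < (2 * G)^-1.
  apply: filter_forall => k.
  have /cvgrPdist_lt/(_ _ G1) := Xlim k; apply: filterS => n.
  by rewrite sub0r normrN ger0_norm ?form_norm_ge0.
apply: filterS near1 => n hn c; set x := \sum_i _ *: _.
have ci i : abs1 (c i) <= 2 * nrm (g i) * (nrm x + \sum_j abs1 (c j) * (2 * G)^-1).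
  have -> : c i = <|g i, x - \sum_j c j *: (Xs j n - X j)|>.
    rewrite /x -sumrB (eq_bigr (fun j => c j *: X j)) => [|j _].
      rewrite scalar_product_sumr (bigD1 i) //= big1 ?addr0 => [|j ji].
        by rewrite scalar_productZr scalar_productC Xg eqxx rmorph_nat mulr1.
      by rewrite scalar_productZr scalar_productC Xg (negPf ji) rmorph_nat mulr0.
    by rewrite -scalerBr opprB addrC subrK.
  apply: le_trans (abs1_scalar_product _ _ _) _.
  rewrite mulrA ler_wpM2l ?mulr_ge0 ?form_norm_ge0 //.
  apply: le_trans (form_norm_triangle rdP _ _) _.
  rewrite (form_normN rdP) lerD2l; apply: le_trans (form_norm_sum _ _ _) _.
  apply: ler_sum => j _; apply: le_trans (form_norm_scale _ _ _) _.
  by rewrite ler_wpM2l ?abs1_ge0 // ltW.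
set s := \sum_i abs1 (c i).
have hs : s <= (\sum_i 2 * nrm (g i)) * (nrm x + s * (2 * G)^-1).
  by rewrite /s [leRHS]mulr_suml [in leRHS]mulr_suml; apply: ler_sum.
have s0 : 0 <= s by apply: sumr_ge0 => i _; exact: abs1_ge0.
have : s <= G * (nrm x + s * (2 * G)^-1).
  apply: le_trans hs _; rewrite ler_wpM2r ?lerDr //.
  by rewrite addr_ge0 ?form_norm_ge0 // mulr_ge0 // ltW.
have -> : G * (nrm x + s * (2 * G)^-1) = G * nrm x + s / 2.
  by field; rewrite gt_eqF.
lra.
Qed.

Lemma cvg_abs1 (u : nat -> R[i]) (l : R[i]) :
  (u n : R[i]^o) @[n --> \oo] --> (l : R[i]^o) ->
  abs1 (u n - l) @[n --> \oo] --> (0 : R).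
Proof.
move=> h; apply/cvgrPdist_le => e e0.
have e2 : 0 < (e / 2)%:C by rewrite ltcR divr_gt0.
move/cvgrPdist_lt: h => /(_ _ e2); apply: filterS => n /=.
rewrite normc_def ltcR sub0r normrN ger0_norm ?abs1_ge0 //.
rewrite -abs1N opprB; case: (l - u n) => a b /= h; rewrite /abs1 /=.
have ha : `|a| <= Num.sqrt (a ^+ 2 + b ^+ 2).
  by rewrite -sqrtr_sqr ler_wsqrtr // lerDl sqr_ge0.
have hb : `|b| <= Num.sqrt (a ^+ 2 + b ^+ 2).
  by rewrite -sqrtr_sqr ler_wsqrtr // lerDr sqr_ge0.
by move: ha hb h; move: (Num.sqrt _) => r; lra.
Qed.

Lemma cvg_abs1_scalar_product (u v : nat -> H) x y :
  nrm (u n - x) @[n --> \oo] --> (0 : R) -> nrm (v n - y) @[n --> \oo] --> (0 : R) ->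
  abs1 (<|u n, v n|> - <|x, y|>) @[n --> \oo] --> (0 : R).
Proof.
move=> ux vy.
have c1 := cvg_re_product ux vy.
have ux' : nrm ('i%C *: u n - 'i%C *: x) @[n --> \oo] --> (0 : R).
  by under eq_fun do rewrite -scalerBr nrm_i.
have c2 := cvg_re_product ux' vy.
have c3 : (`|rd (u n) (v n) - rd x y| + `|rd ('i%C *: u n) (v n) - rd ('i%C *: x) y|)
    @[n --> \oo] --> (`|rd x y - rd x y| + `|rd ('i%C *: x) y - rd ('i%C *: x) y| : R).
  by apply: cvgD; apply: cvg_norm; apply: cvgB => //; exact: cvg_cst.
rewrite !subrr !normr0 addr0 in c3.
apply: cvg_trans c3; apply: near_eq_cvg; apply: nearW => n /=.
by rewrite !scalar_product_re.
Qed.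

Lemma trial_space_has_dim m (Xs : 'I_m -> nat -> H) n :
  exists d, has_dim (trial_space Xs n) d.
Proof.
pose I : finType := ('I_m * 'I_n)%type.
(* The shift by one matches indices of ['I_n] with the range from [1] to [n] in [trial_space]. *)
pose b (e : 'I_#|I|) := Xs (enum_val e).1 (enum_val e).2.+1.
apply: (has_dim_exists (d := #|I|)); first exact: linear_span_linear.
move=> p u uf uV.
have := @free_family_card _ _ _ u _ b uf; rewrite card_ord; apply => i.
apply: (linear_span_sub (linear_span_linear _) _ (uV i)) => _ [k [s [/andP[s1 sn] ->]]].
have sn' : (s.-1 < n)%N by rewrite prednK.
apply: linear_span_gen; exists (enum_rank (k, Ordinal sn')) => //.
by rewrite /b enum_rankK /= prednK.
Qed.

End RitzVectors.

(** * Two-sided estimate of the Ritz values *)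

Theorem theorem6p1 (R : realType) (H : completeNormedModType R[i])
    (dot : {dot H for Num.conj})
    (norm_dot : forall x : H, `|x| ^+ 2 = scalar_product dot x x)
    (H_separable : separable H)
    (F : operator H) (F_sa : self_adjoint dot F)
    (F_lower : lower_semi_definite dot F)
    (Q : set H) (q : H -> H -> R[i]) (qF : form_of_operator dot F Q q)
    (m : nat) (m_ge1 : (1 <= m)%N)
    (lam : 'I_m -> R)
    (lam_initial : initial_eigenvalues (dom F) F
       [set mu : R | discrete_spectrum F mu%:C /\
                     (mu%:E < inf_essential_spectrum F)%E] lam)
    (X : 'I_m -> H) (X_free : lin_indep X)
    (X_eigen : forall k, dom F (X k) /\ F (X k) = (lam k)%:C *: X k)
    (Xs : 'I_m -> nat -> H)
    (Xs_Q : forall k n, (1 <= n)%N -> Q (Xs k n))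
    (Xs_lim : forall k, Xs k n @[n --> \oo] --> X k)
    (q_lim : forall k l : 'I_m,
       (q (Xs k n) (Xs l n) : R[i]^o) @[n --> \oo]
         --> (scalar_product dot (X k) (F (X l)) : R[i]^o))
    (FV : nat -> H -> H)
    (FV_generated : forall n, (1 <= n)%N ->
       generated_operator dot q (trial_space Xs n) (FV n))
    (muhat : nat -> 'I_m -> R)
    (muhat_initial : forall n d, (1 <= n)%N -> has_dim (trial_space Xs n) d ->
       (m <= d)%N ->
       initial_eigenvalues (trial_space Xs n) (FV n)
         [set mu : R | is_eigenvalue (trial_space Xs n) (FV n) mu%:C] (muhat n)) :
  forall k : 'I_m, muhat n k @[n --> \oo] --> lam k.
Proof.
have [A [B [S [absA sqrtB sgnS QE qE]]]] := qF; subst Q.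
have Bsa : self_adjoint dot B by case: sqrtB.
have [[Scont Ssym] [AF _] _ _] := sgnS.
have Blin := self_adjoint_dom Bsa.
have BlinT : linear_on (dom B) B by move=> a y z Dy Dz; exact: op_linear.
have rdP := re_product_form dot.
pose rd := re_product dot; pose nrm := form_norm rd.
have F_sym x y : dom F x -> dom F y ->
    scalar_product dot x (F y) = scalar_product dot (F x) y.
  exact: self_adjoint_sym.
have VQ n : trial_space Xs n `<=` dom B.
  by apply: linear_span_sub => // _ [l [s [/andP[s1 _] ->]]]; exact: Xs_Q.
have Vlin n : linear_set (trial_space Xs n) by exact: linear_span_linear.
have q_herm x y : dom B x -> dom B y -> q x y = (q y x)^*.
  by move=> Bx By; rewrite !qE // -scalar_productC Ssym.
have qre x : dom B x -> complex.Re (q x x) = rd (B x) (S (B x)).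
  by move=> Bx; rewrite qE.
have FVV n x : (1 <= n)%N -> trial_space Xs n x -> trial_space Xs n (FV n x).
  by move=> n1 Vx; exact: (FV_generated n n1 x Vx).1.
have FVq n x y : (1 <= n)%N -> trial_space Xs n x -> trial_space Xs n y ->
    scalar_product dot y (FV n x) = q y x.
  by move=> n1 Vx; exact: (FV_generated n n1 x Vx).2.
(* Linearity comes from the form: the defect [w] lies in the trial space and is orthogonal to
   itself. *)
have FVlin n : (1 <= n)%N -> linear_on (trial_space Xs n) (FV n).
  move=> n1 a x y Vx Vy; apply/eqP; rewrite -subr_eq0.
  set w := _ - _.
  have Vxy : trial_space Xs n (a *: x + y) by exact: (Vlin n).2.
  have Vw : trial_space Xs n w.
    apply: linear_setB => //; first exact: FVV.
    by apply: (Vlin n).2; exact: FVV.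
  apply/eqP/(@scalar_product_eq0 _ _ dot).
  rewrite {2}/w scalar_productDr scalar_productNr.
  rewrite scalar_productDr scalar_productZr !FVq //.
  have [Bw Bx By] : [/\ dom B w, dom B x & dom B y] by split; exact: (VQ n).
  rewrite !qE //; last exact: Blin.2.
  rewrite BlinT // linearP scalar_productDr scalar_productZr.
  exact: subrr.
have FVsym n x y : (1 <= n)%N -> trial_space Xs n x -> trial_space Xs n y ->
    scalar_product dot x (FV n y) = scalar_product dot (FV n x) y.
  move=> n1 Vx Vy; rewrite [RHS]scalar_productC !FVq //.
  by apply: q_herm; exact: (VQ n).
have FVre n x : (1 <= n)%N -> trial_space Xs n x ->
    rd x (FV n x) = complex.Re (q x x).
  by move=> n1 Vx; rewrite /rd /re_product FVq.
have [c Fc] : exists c : R, forall x, dom F x -> c * rd x x <= rd x (F x).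
  have [_ [c hc]] := F_lower; exists c => x Dx.
  have := hc x Dx; rewrite norm_dot scalar_product_self -rmorphM /=.
  by rewrite lecE => /andP[_].
have XF j : dom F (X j) := (X_eigen j).1.
(* With the empty index set the orthogonality condition is void, so the bound [c] passes to the
   whole form domain. *)
have qc x : dom B x -> c * rd x x <= rd (B x) (S (B x)).
  move=> Bx; apply: (form_lower_extension norm_dot (J := pred0)
    F_sa absA sqrtB sgnS X_free XF) => // y Dy _; exact: Fc.
have Xs_nrm k : nrm (Xs k n - X k) @[n --> \oo] --> (0 : R).
  exact/(cvg_form_norm norm_dot)/Xs_lim.
have vE n : (1 <= n)%N -> (exists d, has_dim (trial_space Xs n) d /\ (m <= d)%N) ->
    exists v : 'I_m -> H, [/\ lin_indep v,
      forall k, eigenvectors (trial_space Xs n) (FV n) (muhat n k)%:C (v k)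
    & forall k j, muhat n k != muhat n j -> scalar_product dot (v k) (v j) = 0].
  move=> n1 [d [Vd md]].
  have orth a b x y := @eigenvectors_orthogonal _ _ dot (trial_space Xs n) (FV n)
    a b x y (fun x y => @FVsym n x y n1).
  have [v vf vT] := eigenvector_choice orth (muhat_initial n d n1 Vd md).
  by exists v; split => // k j kj; exact: orth kj (vT k) (vT j).
have comb_neq0 (u : 'I_m -> H) (a : 'I_m -> R[i]) : lin_indep u ->
    (exists i, a i != 0) -> 0 < rd (\sum_i a i *: u i) (\sum_i a i *: u i).
  move=> uf [i ai]; rewrite lt_neqAle form_ge0 // andbT eq_sym.
  apply: contra_neq ai => /re_product_definite h; exact: uf h i.
have lower n k : (1 <= n)%N ->
    (exists d, has_dim (trial_space Xs n) d /\ (m <= d)%N) -> lam k <= muhat n k.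
  move=> n1 nd; have [d [Vd md]] := nd; have [v [vf vT vorth]] := vE n n1 nd.
  have [a [a0 ak aorth]] :=
    exists_annihilated k (fun j i => scalar_product dot (X j) (v i)).
  set x := \sum_i a i *: v i.
  have Vv i : trial_space Xs n (v i) by exact: (vT i).1.
  have Vx : trial_space Xs n x.
    by apply: linear_set_sum => // i _; exact: linear_setZ.
  (* As [lam] is non-decreasing, [lam j < lam k] forces [j < k], so the imposed conditions cover all
     these [j]. *)
  have Yx : orthogonal_to dot X [pred j | lam j < lam k] x.
    move=> j /= jk; rewrite scalar_product_sumr.
    under eq_bigr do rewrite scalar_productZr.
    apply: aorth; rewrite ltnNge; apply/negP => kj.
    by have [/(_ k j kj)] := lam_initial; rewrite leNgt jk.
  have Bx : dom B x by exact: (VQ n _ Vx).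
  have h1 := form_lower_extension norm_dot F_sa absA sqrtB sgnS X_free XF
    (spectral_lower_bound norm_dot F_sa F_lower X_free lam_initial X_eigen (k := k))
    Bx Yx.
  have h2 : rd x (FV n x) <= muhat n k * rd x x.
    rewrite /x (linear_on_sum _ (Vlin n) (FVlin n n1) Vv).
    under [X in rd _ X]eq_bigr do rewrite (vT _).2 scalerA.
    apply: eigen_combination_le => // i; case: (leqP i k) => [ik|ki].
      by right; have [/(_ i k ik)] := muhat_initial n d n1 Vd md.
    by left; exact: ak.
  rewrite FVre // qre // in h2.
  by rewrite -(ler_pM2r (comb_neq0 v a vf a0)) (le_trans h1).
have [G G0 Gnear] := coefficient_bound X_free Xs_nrm.
move=> k; apply/cvgrPdist_le => e e0.
(* By the coefficient bound, entrywise errors of size [eta] change the form at [x] by at most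
   [e * rd x x]. *)
pose eta := e / G ^+ 2.
have eta0 : 0 < eta by rewrite divr_gt0 // exprn_gt0.
(* Matrices of [q] minus [lam k] times the scalar product, on the approximants and on the
   eigenvectors. *)
pose alpha n i j := q (Xs i n) (Xs j n) -
  (lam k)%:C * scalar_product dot (Xs i n) (Xs j n).
pose beta i j := scalar_product dot (X i) (F (X j)) -
  (lam k)%:C * scalar_product dot (X i) (X j).
have near_eta : \forall n \near \oo, forall i j, abs1 (alpha n i j - beta i j) <= eta.
  apply: filter_forall => i; apply: filter_forall => j.
  have h1 := cvg_abs1 (q_lim i j).
  have h2 := cvg_abs1_scalar_product (Xs_nrm i) (Xs_nrm j).
  have h3 : (abs1 (q (Xs i n) (Xs j n) - scalar_product dot (X i) (F (X j))) +
      abs1 (lam k)%:C * abs1 (scalar_product dot (Xs i n) (Xs j n) -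
        scalar_product dot (X i) (X j))) @[n --> \oo] --> (0 + abs1 (lam k)%:C * 0 : R).
    by apply: cvgD => //; exact: cvgMl_tmp.
  rewrite mulr0 addr0 in h3.
  move/cvgrPdist_le: h3 => /(_ _ eta0); apply: filterS => n.
  rewrite sub0r normrN ger0_norm; last by rewrite addr_ge0 ?mulr_ge0 ?abs1_ge0.
  apply: le_trans; apply: (le_trans _ (lerD (lexx _) (abs1M _ _))).
  rewrite -[X in _ <= _ + X]abs1N; apply: (le_trans _ (abs1D _ _)).
  by rewrite le_eqVlt; apply/orP; left; apply/eqP; congr abs1; rewrite /alpha /beta; ring.
near=> n.
have n1 : (1 <= n)%N by near: n; exact: nbhs_infty_ge.
have hG : forall c : 'I_m -> R[i],
    \sum_i abs1 (c i) <= G * nrm (\sum_i c i *: Xs i n) by near: n.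
have heta : forall i j, abs1 (alpha n i j - beta i j) <= eta by near: n.
(* For large [n] the approximants are independent, so the trial space has dimension at least [m] and
   [muhat_initial] applies. *)
have Xs_free : lin_indep (fun i => Xs i n).
  move=> a a0 i; apply: abs1_eq0; apply: (@le_trans _ _ (\sum_i abs1 (a i))).
    by rewrite (bigD1 i) //= lerDl sumr_ge0 // => j _; exact: abs1_ge0.
  by apply: le_trans (hG a) _; rewrite a0 /nrm /form_norm /rd (form0r rdP) sqrtr0 mulr0.
have VXs i : trial_space Xs n (Xs i n).
  by apply: linear_span_gen; exists i, n; rewrite n1 leqnn.
have [d Vd] := trial_space_has_dim Xs n.
have md : (m <= d)%N := has_dim_card Vd Xs_free VXs.
have nd : exists d, has_dim (trial_space Xs n) d /\ (m <= d)%N by exists d.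
have upper : muhat n k <= lam k + e.
  have [v [vf vT _]] := vE n n1 nd.
  have [a [a0 ak aorth]] :=
    exists_annihilated k (fun j i => scalar_product dot (v j) (Xs i n)).
  set x := \sum_i a i *: Xs i n.
  have Vx : trial_space Xs n x.
    by apply: linear_set_sum => // i _; exact: linear_setZ.
  have mu_init := muhat_initial n d n1 Vd md.
  have Yx : orthogonal_to dot v [pred j | muhat n j < muhat n k] x.
    move=> j /= jk; rewrite scalar_product_sumr.
    under eq_bigr do rewrite scalar_productZr.
    apply: aorth; rewrite ltnNge; apply/negP => kj.
    by have [/(_ k j kj)] := mu_init; rewrite leNgt jk.
  have h1 : muhat n k * rd x x <= rd x (FV n x).
    apply: (finite_spectral_lower_bound (c := c) Vd _ _ _ _ vf vT mu_init) => //.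
    - by move=> y; exact: FVV.
    - exact: FVlin.
    - by move=> y z; exact: FVsym.
    - by move=> y Vy; rewrite -/rd FVre // qre; [exact/qc/(VQ n)|exact: (VQ n)].
  have Bx : dom B x by exact: (VQ n _ Vx).
  have BXs i : dom B (Xs i n) by exact: (VQ n _ (VXs i)).
  have h2 : complex.Re (q x x) - lam k * rd x x =
      complex.Re (\sum_i \sum_j (a i)^* * (a j * alpha n i j)).
    rewrite /rd /re_product (_ : lam k * _ =
      complex.Re ((lam k)%:C * scalar_product dot x x)); last first.
      by case: (scalar_product dot x x) => u w /=; rewrite mul0r subr0.
    rewrite -raddfB /=; congr complex.Re.
    rewrite qE // {1 2}/x (linear_on_sum _ Blin BlinT) // linear_sum.
    under [X in scalar_product dot _ X - _]eq_bigr do rewrite linearZ_LR.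
    rewrite scalar_product_sum2 /x scalar_product_sum2 mulr_sumr -sumrB.
    apply: eq_bigr => i _; rewrite mulr_sumr -sumrB; apply: eq_bigr => j _.
    by rewrite /alpha qE //; ring.
  (* The same coefficients on the exact eigenvectors: they vanish beyond [k], so the shifted form is
     nonpositive at [w], hence at most [e * rd x x] at [x]. *)
  pose w := \sum_i a i *: X i.
  have h3 : complex.Re (\sum_i \sum_j (a i)^* * (a j * beta i j)) =
      rd w (\sum_i (a i * (lam i)%:C) *: X i) - lam k * rd w w.
    rewrite /rd /re_product (_ : lam k * _ =
      complex.Re ((lam k)%:C * scalar_product dot w w)); last first.
      by case: (scalar_product dot w w) => u z /=; rewrite mul0r subr0.
    rewrite -raddfB /=; congr complex.Re.
    under [in RHS]eq_bigr do rewrite -scalerA.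
    rewrite /w !scalar_product_sum2 mulr_sumr -sumrB.
    apply: eq_bigr => i _; rewrite mulr_sumr -sumrB; apply: eq_bigr => j _.
    by rewrite /beta (X_eigen j).2 !scalar_productZr; ring.
  have h4 : rd w (\sum_i (a i * (lam i)%:C) *: X i) <= lam k * rd w w.
    apply: eigen_combination_le => [i j ij|i].
      exact: (eigenvectors_orthogonal F_sym ij (X_eigen i) (X_eigen j)).
    case: (leqP i k) => [ik|ki]; last by left; exact: ak.
    by right; have [/(_ i k ik)] := lam_initial.
  have h5 := sesquilinear_perturbation a heta.
  have h6 : eta * (\sum_i abs1 (a i)) ^+ 2 <= e * rd x x.
    rewrite /eta -mulrA ler_pM2l // mulrC ler_pdivrMr ?exprn_gt0 //.
    rewrite /rd -(form_norm_sqr rdP) mulrC -exprMn ler_pXn2r ?nnegrE //.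
    - by apply: sumr_ge0 => i _; exact: abs1_ge0.
    - by rewrite mulr_ge0 ?form_norm_ge0 // ltW.
  rewrite -(ler_pM2r (comb_neq0 _ a Xs_free a0)) (le_trans h1) // FVre //.
  by rewrite -/x mulrDl -lerBlDl h2; lra.
have lo := lower n k n1 nd.
by rewrite ler_norml; apply/andP; split; lra.
Unshelve. all: by end_near.
Qed.
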